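(* Let $F$ be a tree on $\ell\geq 4$ vertices, let $A,B$ be the partite sets of $F$ with $|A|\leq|B|$, $q=|A|-1$ and $\delta=\min\{d_F(x):x\in A\}$. Suppose $q\geq 1$ and $n$ is sufficiently large. Then ${\rm SPEX}(n,F)\subseteq \mathcal{H}(n,q,\mathcal{A})$ if and only if $\delta=1$, where $\mathcal{H}(n,q,\mathcal{A})=\{Q\nabla (n-q)K_1 : Q\in {\rm EX}(q,\mathcal{A})\}$. Furthermore: (i) ${\rm SPEX}(n,F)=\{K_{q,n-q}\}$ if and only if $\delta=1$ and the edgeless graph $qK_1$ is the only member of ${\rm EX}(q,\mathcal{A})$ (up to isomorphism); (ii) ${\rm SPEX}(n,F)=\{S_{n,q}^{0}\}$ if and only if $\delta=1$ and $\beta(F)=q+1$.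
   Context: $\beta(F)$ is the minimum size of a vertex cover of $F$ (note $\beta(F)\leq q+1$). If $\beta(F)=q+1$, set $\mathcal{A}=\{K_{q+1}\}$; otherwise set $\mathcal{A}=\{F[S] : S \text{ is a vertex cover of } F \text{ with } |S|\leq q\}$, where $F[S]$ is the subgraph of $F$ induced by $S$. A graph is $\mathcal{A}$-free if it contains no member of $\mathcal{A}$ as a subgraph; ${\rm ex}(q,\mathcal{A})$ is the maximum number of edges of an $\mathcal{A}$-free graph on $q$ vertices and ${\rm EX}(q,\mathcal{A})$ the set of $\mathcal{A}$-free $q$-vertex graphs with ${\rm ex}(q,\mathcal{A})$ edges. $Q\nabla (n-q)K_1$ is the join of $Q$ with an independent set of $n-q$ vertices. ${\rm SPEX}(n,F)$ is the set of $F$-free $n$-vertex graphs of maximum adjacency spectral radius. $S_{n,q}^{0}=K_q\nabla (n-q)K_1$. *)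

(* Defs.v *)
From HB Require Import structures.
From mathcomp Require Import all_boot all_order all_algebra all_field.

Set Implicit Arguments.
Unset Strict Implicit.
Unset Printing Implicit Defensive.

Import Order.TTheory GRing.Theory Num.Theory.

Record sgraph := SGraph {
  vertex :> finType;
  adj : rel vertex;
  adj_sym : symmetric adj;
  adj_irrefl : irreflexive adj }.

Definition iso (G H : sgraph) : Prop :=
  exists2 f : G -> H, bijective f & forall x y, adj (f x) (f y) = adj x y.

(* [H] is a (not necessarily induced) subgraph of [G], up to isomorphism. *)
Definition contains (G H : sgraph) : Prop :=
  exists2 f : H -> G, injective f & forall x y, adj x y -> adj (f x) (f y).

Definition deg (G : sgraph) (x : G) : nat := #|[set y | adj x y]|.

Definition edges (G : sgraph) : {set {set G}} :=
  [set e | [exists x, exists y, adj x y && (e == [set x; y])]].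

Definition is_tree (G : sgraph) : Prop :=
  [/\ 0 < #|G|,
      forall x y : G, connect (@adj G) x y
    & forall s : seq G, 2 < size s -> ~ ucycle (@adj G) s].

Definition independent (G : sgraph) (S : {set G}) : bool :=
  [forall x in S, forall y in S, ~~ adj x y].

Definition partite_sets (G : sgraph) (A B : {set G}) : Prop :=
  [/\ A :|: B = [set: G], [disjoint A & B], independent A & independent B].

(* Minimum degree in [G] of a vertex of [A]; the default [#|G|] exceeds every
   degree, so it is only the value when [A] is empty. *)
Definition min_deg_in (G : sgraph) (A : {set G}) : nat :=
  \big[minn/#|G|]_(x in A) deg x.

Definition vertex_cover (G : sgraph) (S : {set G}) : bool :=
  [forall x, forall y, adj x y ==> (x \in S) || (y \in S)].

Definition beta (G : sgraph) : nat :=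
  #|[arg min_(S < [set: G] | vertex_cover S) #|S| ]|.

Section Induced.
Variables (G : sgraph) (S : {set G}).
Definition induced_adj : rel {x : G | x \in S} := fun x y => adj (val x) (val y).
Fact induced_sym : symmetric induced_adj.
Proof. by move=> x y; apply: adj_sym. Qed.
Fact induced_irrefl : irreflexive induced_adj.
Proof. by move=> x; apply: adj_irrefl. Qed.
Definition induced : sgraph := SGraph induced_sym induced_irrefl.
End Induced.

Section Basic.
Variable n : nat.
Definition edgeless_adj : rel 'I_n := fun _ _ => false.
Fact edgeless_sym : symmetric edgeless_adj. Proof. by []. Qed.
Fact edgeless_irrefl : irreflexive edgeless_adj. Proof. by []. Qed.
Definition edgeless : sgraph := SGraph edgeless_sym edgeless_irrefl.

Definition complete_adj : rel 'I_n := fun x y => x != y.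
Fact complete_sym : symmetric complete_adj.
Proof. by move=> x y; rewrite /complete_adj eq_sym. Qed.
Fact complete_irrefl : irreflexive complete_adj.
Proof. by move=> x; rewrite /complete_adj eqxx. Qed.
Definition complete : sgraph := SGraph complete_sym complete_irrefl.
End Basic.

Section CompleteBipartite.
Variables m n : nat.
Definition bipartite_adj : rel ('I_m + 'I_n)%type := fun u v =>
  match u, v with inl _, inr _ | inr _, inl _ => true | _, _ => false end.
Fact bipartite_sym : symmetric bipartite_adj. Proof. by case=> x [] y. Qed.
Fact bipartite_irrefl : irreflexive bipartite_adj. Proof. by case. Qed.
Definition complete_bipartite : sgraph := SGraph bipartite_sym bipartite_irrefl.
End CompleteBipartite.

Section Join.
Variables G H : sgraph.
Definition join_adj : rel (G + H)%type := fun u v =>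
  match u, v with
  | inl x, inl y => adj x y
  | inr x, inr y => adj x y
  | _, _ => true
  end.
Fact join_sym : symmetric join_adj.
Proof. by case=> x [] y //=; apply: adj_sym. Qed.
Fact join_irrefl : irreflexive join_adj.
Proof. by case=> x /=; apply: adj_irrefl. Qed.
Definition join : sgraph := SGraph join_sym join_irrefl.
End Join.

(* A class of graphs is a predicate on [sgraph]; set-theoretic statements about
   classes are read up to isomorphism. *)
Definition is_singleton (P : sgraph -> Prop) (H : sgraph) : Prop :=
  forall G, P G <-> iso G H.

Definition family_free (P : sgraph -> Prop) (G : sgraph) : Prop :=
  forall H, P H -> ~ contains G H.

Definition is_ex (n : nat) (P : sgraph -> Prop) (m : nat) : Prop :=
  (exists G : sgraph, [/\ #|G| = n, family_free P G & #|edges G| = m]) /\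
  (forall G : sgraph, #|G| = n -> family_free P G -> #|edges G| <= m).

Definition EX (n : nat) (P : sgraph -> Prop) (G : sgraph) : Prop :=
  [/\ #|G| = n, family_free P G & is_ex n P #|edges G|].

Definition cover_family (F : sgraph) (q : nat) (H : sgraph) : Prop :=
  if beta F == q.+1 then iso H (complete q.+1)
  else exists S : {set F},
    [/\ vertex_cover S, #|S| <= q & iso H (induced S)].

Definition calH (n q : nat) (P : sgraph -> Prop) (G : sgraph) : Prop :=
  exists2 Q, EX q P Q & iso G (join Q (edgeless (n - q))).

Definition S0 (n q : nat) : sgraph := join (complete q) (edgeless (n - q)).

Definition adjmx (G : sgraph) : 'M[algC]_#|G| :=
  (\matrix_(i, j) (adj (enum_val i) (enum_val j))%:R)%R.

(* The eigenvalues with multiplicity, as the roots of the characteristic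
   polynomial. Adjacency matrices are integral, so all their complex
   eigenvalues lie in [algC]. *)
Definition spectrum n (M : 'M[algC]_n) : seq algC :=
  sval (closed_field_poly_normal (char_poly M)).

Lemma mem_spectrum n (M : 'M[algC]_n) (a : algC) :
  (a \in spectrum M) = eigenvalue M a.
Proof.
rewrite eigenvalue_root_char /spectrum.
case: closed_field_poly_normal => r /= Er.
by rewrite Er (monicP (char_poly_monic M)) scale1r root_prod_XsubC.
Qed.

Definition spectral_radius n (M : 'M[algC]_n) : algC :=
  (\big[Num.max/0]_(a <- spectrum M) `|a|)%R.

(* The order of [algC] is partial, but moduli are pairwise comparable. *)
Lemma spectral_radius_ub n (M : 'M[algC]_n) (a : algC) :
  eigenvalue M a -> (`|a| <= spectral_radius M)%R.
Proof.
rewrite -mem_spectrum /spectral_radius; elim: (spectrum M) => // b s IHs.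
have s_ge0: (0 <= \big[Num.max/0]_(c <- s) `|c| :> algC)%R.
  elim/big_ind: _ => // x y x_ge0 y_ge0.
  by rewrite comparable_le_max ?x_ge0 // real_comparable ?ger0_real.
have cmp: (`|b| >=< \big[Num.max/0]_(c <- s) `|c|)%R.
  by rewrite real_comparable ?ger0_real.
rewrite big_cons inE comparable_le_max // => /orP[/eqP-> | /IHs->].
  by rewrite lexx.
by rewrite orbT.
Qed.

Lemma spectral_radius_attained n (M : 'M[algC]_n) : 0 < n ->
  exists2 a, eigenvalue M a & spectral_radius M = `|a|%R.
Proof.
move=> n_gt0; have s_neq0: spectrum M != [::].
  apply/eqP=> s0; have := size_char_poly M.
  move: s0; rewrite /spectrum; case: closed_field_poly_normal => r /= Er r0.
  rewrite Er r0 big_nil (monicP (char_poly_monic M)) scale1r size_poly1.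
  by case=> n0; rewrite -n0 in n_gt0.
suff [a a_in ->]: exists2 a, a \in spectrum M & spectral_radius M = `|a|%R.
  by exists a; rewrite -?mem_spectrum.
move: s_neq0; rewrite /spectral_radius; elim: (spectrum M) => // b [_ _|c s IHs _].
  exists b; rewrite ?mem_head // big_seq1_id.
  by rewrite /Num.max normr_lt0.
have [a a_in Ea] := IHs isT; rewrite big_cons Ea /Num.max.
case: ifP => _; first by exists a; rewrite // inE a_in orbT.
by exists b; rewrite ?mem_head.
Qed.

Definition rho (G : sgraph) : algC := spectral_radius (adjmx G).

Definition SPEX (n : nat) (F G : sgraph) : Prop :=
  [/\ #|G| = n, ~ contains G F
    & forall G' : sgraph, #|G'| = n -> ~ contains G' F -> (rho G' <= rho G)%R].

(* Main.v *)
Require Import Defs.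
From mathcomp Require Import all_boot all_order all_algebra all_field.
From mathcomp Require Import sesquilinear spectral.
From mathcomp Require Import zify ring lra.

(* If every vertex of [A] has degree at least 2, acyclicity gives Hall-type
   expansion from [A] into [B], so [A] is the only vertex cover of size at most
   [q + 1]; hence adding an edge inside the independent part of a join of [Q]
   with [n - q] isolated vertices creates no copy of [F], while it strictly
   raises the spectral radius.

   If [A] contains a leaf, let [x] be a Perron vector of an extremal graph [G],
   scaled to maximum 1. As [K_{q,n-q}] is [F]-free, [rho G ^ 2 >= q (n - q)].
   Edges are linearly many in an [F]-free graph and any [q + 1] vertices have
   boundedly many common neighbours, so counting walks of length 2 from a vertex
   of maximal weight yields [q] vertices [L] of weight close to 1 which are
   adjacent to almost all vertices. A common neighbour of [L] with a neighbour
   outside [L] would complete a copy of [F], with the leaf mapped outside [L];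
   so the remaining vertices have small weight, and rewiring each of them to [L]
   would raise the spectral radius. Thus [G] is the join of [G[L]] with isolated
   vertices, and [G[L]] has as many edges as possible because all weights on [L]
   are close to 1. *)

Set Implicit Arguments.
Unset Strict Implicit.
Unset Printing Implicit Defensive.

Import Order.TTheory GRing.Theory Num.Theory.

(** * Rayleigh quotients and Perron vectors *)

(** Two graphs on one vertex set are compared through the quadratic form of a single Perron vector
    [x] of [G]. Connectedness is not known beforehand, so [x] may vanish somewhere and a gain in the
    form may be zero. The equality case of the Rayleigh bound then makes [x] an eigenvector of the
    competitor too, and the eigenvector equation at single vertices gives the contradiction. The
    heavy vertices cannot be bounded in one pass. Weight [eta] alone gives degree of order [lam],
    hence up to about sqrt n heavy vertices. Walks of length 2, where these enter only as an error
    term, raise the degree to order [n], and the linear degree sum then leaves a number [K] of heavy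
    vertices independent of [n]. Now all sets of [q + 1] heavy vertices can be listed at constant
    cost, which confines the vertices with more than [q] heavy neighbours to a bounded set. Sparsity
    of an [F]-free graph enters as degeneracy rather than as an edge count, since degeneracy also
    bounds weighted edge sums inside every vertex subset. *)

Section HermitianRayleigh.
Local Open Scope ring_scope.
Local Open Scope sesquilinear_scope.
Variables (n : nat) (M : 'M[algC]_n).
Hypothesis M_herm : M \is hermsymmx.

Lemma spectral_radius_ge0 : 0 <= spectral_radius M.
Proof.
have [n0|n_gt0] := posnP n; last first.
  by have [a _ ->] := spectral_radius_attained M n_gt0.
rewrite /spectral_radius; elim: (spectrum M) => [|b s IHs]; rewrite ?big_nil //.
by rewrite big_cons /Num.max; case: ifP.
Qed.

Let P := spectralmx M.
Let d := spectral_diag M.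

Lemma spectral_diag_le_radius i : d 0 i <= spectral_radius M.
Proof.
have /hermitian_normalmx /orthomx_spectralP ME := M_herm.
have Pu : P \in unitmx := spectral_unit M.
suff /spectral_radius_ub : eigenvalue M (d 0 i).
  apply: le_trans; apply: real_ler_norm.
  by move: (hermitian_spectral_diag_real M_herm) => /mxOverP; apply.
apply/eigenvalueP; exists (row i P).
  rewrite -row_mul ME !mulmxA mulmxV // mul1mx.
  by rewrite row_mul row_diag_mx -scalemxAl -rowE.
apply/eqP => P0; have /matrixP/(_ 0 i)/eqP : delta_mx 0 i = 0 :> 'rV[algC]_n.
  by rewrite -(mulmxK Pu (delta_mx 0 i)) -rowE P0 mul0mx.
by rewrite !mxE !eqxx oner_eq0.
Qed.

Lemma spectral_form (y : 'rV[algC]_n) : let w := y *m P^t* in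
  (y *m M *m y^t*) 0 0 = \sum_i d 0 i * `|w 0 i| ^+ 2 /\
  (y *m y^t*) 0 0 = \sum_i `|w 0 i| ^+ 2.
Proof.
move=> w; have /hermitian_normalmx /orthomx_spectralP ME := M_herm.
have Pu : P \is unitarymx := spectral_unitarymx M.
have wt : w^t* = P *m y^t*.
  by rewrite /w trmx_mul map_mxM trmxCK.
split.
  rewrite {1}ME invmx_unitary // !mulmxA -/w -mulmxA -wt mxE.
  apply: eq_bigr => i _; rewrite mul_mx_diag !mxE normCK mulrA.
  by rewrite [d _ _ * _]mulrC.
have <- : w *m w^t* = y *m y^t*.
  rewrite wt /w mulmxA -[y *m _ *m P]mulmxA -(invmx_unitary Pu).
  by rewrite mulVmx ?mulmx1 // spectral_unit.
by rewrite mxE; apply: eq_bigr => i _; rewrite !mxE normCK.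
Qed.

Lemma rayleigh_mx (y : 'rV[algC]_n) :
  (y *m M *m y^t*) 0 0 <= spectral_radius M * (y *m y^t*) 0 0.
Proof.
have [-> ->] := spectral_form y; rewrite mulr_sumr; apply: ler_sum => i _.
by apply: ler_wpM2r; rewrite ?exprn_ge0 // spectral_diag_le_radius.
Qed.

(** In the eigenbasis the deficit is a sum of nonnegative terms
    [(spectral_radius M - d 0 i) * |w 0 i|^2], so equality kills every coordinate outside the top
    eigenspace. *)
Lemma rayleigh_mx_eq (y : 'rV[algC]_n) :
  spectral_radius M * (y *m y^t*) 0 0 <= (y *m M *m y^t*) 0 0 ->
  y *m M = spectral_radius M *: y.
Proof.
have [-> ->] := spectral_form y; set w := y *m P^t*; rewrite mulr_sumr => le.
have Pu : P \is unitarymx := spectral_unitarymx M.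
have /hermitian_normalmx /orthomx_spectralP ME := M_herm.
have yw : y = w *m P.
  rewrite /w -mulmxA -(invmx_unitary Pu).
  by rewrite mulVmx ?mulmx1 // spectral_unit.
have ge0 i : 0 <= (spectral_radius M - d 0 i) * `|w 0 i| ^+ 2.
  by rewrite mulr_ge0 ?exprn_ge0 ?subr_ge0 ?spectral_diag_le_radius.
have s0 : \sum_i (spectral_radius M - d 0 i) * `|w 0 i| ^+ 2 = 0.
  apply/le_anti; rewrite sumr_ge0 ?andbT; last by move=> i _; exact: ge0.
  rewrite -subr_le0 -sumrB in le; apply: le_trans le.
  by apply: ler_sum => i _; rewrite mulrBl.
have e0 i : w 0 i * d 0 i = spectral_radius M * w 0 i.
  have /eqP : (spectral_radius M - d 0 i) * `|w 0 i| ^+ 2 = 0.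
    apply: (psumr_eq0P _ s0) => // j _; exact: ge0.
  rewrite mulf_eq0 sqrf_eq0 normr_eq0 => /orP[|/eqP ->].
    by rewrite subr_eq0 => /eqP <-; rewrite mulrC.
  by rewrite mul0r mulr0.
rewrite {1}yw {1}ME -mulmxA [P *m (_ *m _)]mulmxA [P *m (_ *m _)]mulmxA.
rewrite mulmxV ?spectral_unit // mul1mx mulmxA yw scalemxAl.
congr (_ *m _); apply/matrixP => i j; rewrite ord1 mul_mx_diag [LHS]mxE [RHS]mxE.
exact: e0.
Qed.

End HermitianRayleigh.

Section GraphSpectrum.
Local Open Scope ring_scope.
Local Open Scope sesquilinear_scope.
Variable G : sgraph.

(** The eigenvector equation vertex by vertex, free of the enumeration that indexes [adjmx]. It is
    generic in [R] to serve both [algC] and [algR]. *)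
Definition eigenfun (R : nzRingType) (a : R) (x : G -> R) :=
  forall u, \sum_(v | adj u v) x v = a * x u.

Lemma sum_enum_val (R : nmodType) (f : G -> R) :
  \sum_i f (@enum_val G G i) = \sum_u f u.
Proof.
by rewrite (reindex (@enum_rank G)) /=; [apply: eq_bigr => i _; rewrite enum_rankK
  | exists enum_val => ? _; rewrite ?enum_rankK ?enum_valK].
Qed.

Definition fun_row (x : G -> algC) : 'rV[algC]_#|G| := \row_i x (enum_val i).

Lemma fun_row_mul (x : G -> algC) i :
  (fun_row x *m adjmx G) 0 i = \sum_(v | adj (enum_val i) v) x v.
Proof.
rewrite mxE [RHS]big_mkcond -sum_enum_val /=.
apply: eq_bigr => j _; rewrite !mxE adj_sym.
by case: adj; rewrite ?mulr1 ?mulr0.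
Qed.

Lemma eigenvalue_adjmxP (a : algC) :
  reflect (exists2 x : G -> algC, eigenfun a x & exists u, x u != 0)
          (eigenvalue (adjmx G) a).
Proof.
apply: (iffP eigenvalueP) => [[v vE v0]|[x xE [u xu]]].
  have vx : v = fun_row (fun u => v 0 (enum_rank u)).
    by apply/rowP => i; rewrite mxE enum_valK.
  exists (fun u => v 0 (enum_rank u)).
    move=> u; have /rowP/(_ (enum_rank u)) := vE.
    by rewrite {1}vx fun_row_mul enum_rankK mxE.
  have /rV0Pn [i vi] := v0.
  by exists (enum_val i); rewrite enum_valK.
exists (fun_row x).
  by apply/rowP => i; rewrite fun_row_mul xE !mxE.
by apply/rV0Pn; exists (enum_rank u); rewrite mxE enum_rankK.
Qed.

Lemma adjmx_herm : adjmx G \is hermsymmx.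
Proof.
apply: realsym_hermsym.
  apply/is_hermitianmxP; rewrite expr0 scale1r.
  by apply/matrixP => i j; rewrite !mxE adj_sym.
by apply/mxOverP => i j; rewrite mxE; case: adj; rewrite ?real0 ?real1.
Qed.

(** The order of [algC] is partial, while [algR] is a real closed field. An inequality between
    values of [rhoR] is convertible to the one between values of [rho]. *)
Definition rhoR : algR := in_algR (ger0_real (spectral_radius_ge0 (adjmx G))).

Lemma rhoR_ge0 : 0 <= rhoR.
Proof. exact: spectral_radius_ge0. Qed.

Lemma fun_row_form (x : G -> algR) :
  (fun_row x *m adjmx G *m (fun_row x)^t*) 0 0
    = algRval (\sum_u x u * \sum_(v | adj u v) x v) /\
  (fun_row x *m (fun_row x)^t*) 0 0 = algRval (\sum_u x u ^+ 2).
Proof.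
split; rewrite mxE rmorph_sum -sum_enum_val; apply: eq_bigr => i _.
  rewrite fun_row_mul !mxE (CrealP (algRvalP _)) mulrC rmorphM rmorph_sum.
  by [].
by rewrite !mxE (CrealP (algRvalP _)) -expr2 -rmorphXn.
Qed.

Lemma rayleigh (x : G -> algR) :
  \sum_u x u * \sum_(v | adj u v) x v <= rhoR * \sum_u x u ^+ 2.
Proof.
have := rayleigh_mx adjmx_herm (fun_row x).
by have [-> ->] := fun_row_form x.
Qed.

Lemma rayleigh_eq (x : G -> algR) :
  rhoR * (\sum_u x u ^+ 2) <= \sum_u x u * \sum_(v | adj u v) x v ->
  eigenfun rhoR x.
Proof.
move=> le; have := @rayleigh_mx_eq _ _ adjmx_herm (fun_row x).
have [-> ->] := fun_row_form x => /(_ le) /rowP eq u.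
have := eq (enum_rank u); rewrite fun_row_mul !mxE enum_rankK => e.
by apply: val_inj; rewrite /= -e rmorph_sum.
Qed.

Lemma eigenfun_le_rho (a : algR) (x : G -> algR) :
  eigenfun a x -> (exists u, x u != 0) -> a <= rhoR.
Proof.
move=> xE [u xu]; suff : eigenvalue (adjmx G) (algRval a).
  move=> /spectral_radius_ub; apply: le_trans.
  exact: real_ler_norm (algRvalP a).
apply/eigenvalue_adjmxP; exists (fun u => algRval (x u)).
  by move=> w; rewrite -rmorph_sum xE rmorphM.
by exists u; apply: contra xu => /eqP x0; apply/eqP/val_inj.
Qed.

(** By the triangle inequality, the moduli of an eigenvector whose eigenvalue has maximal modulus
    attain the Rayleigh bound, so they form an eigenvector for the radius itself. Positivity
    everywhere is not claimed, as [G] may be disconnected. *)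
Lemma perron_fun : (0 < #|G|)%N -> exists x : G -> algR,
  [/\ eigenfun rhoR x, forall u, 0 <= x u & exists u, 0 < x u].
Proof.
move=> G_gt0; have [a /eigenvalue_adjmxP[z zE [u0 zu0]] aE] :=
  spectral_radius_attained (adjmx G) G_gt0.
pose x u := in_algR (normr_real (z u)).
exists x; split; last 2 first.
- by move=> u; exact: normr_ge0.
- exists u0; rewrite lt_def; apply/andP; split; last exact: normr_ge0.
  by rewrite -(inj_eq val_inj) /= normr_eq0.
apply: rayleigh_eq; rewrite mulr_sumr; apply: ler_sum => u _.
rewrite expr2 mulrCA; apply: ler_wpM2l; first exact: normr_ge0.
have -> : rhoR * x u = in_algR (normr_real (\sum_(v | adj u v) z v)).
  by apply: val_inj; rewrite /= /rhoR aE -normrM zE.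
change (`|\sum_(v | adj u v) z v| <= algRval (\sum_(v | adj u v) x v)).
by rewrite rmorph_sum; apply: ler_norm_sum.
Qed.

End GraphSpectrum.

(** * Forests *)

Definition nbr (G : sgraph) (u : G) : {set G} := [set v | adj u v].

Lemma in_nbr (G : sgraph) (u v : G) : (v \in nbr u) = adj u v.
Proof. by rewrite inE. Qed.

Definition acyclic (G : sgraph) : Prop :=
  forall s : seq G, 2 < size s -> ~ ucycle (@adj G) s.

Section Forest.
Variable F : sgraph.
Hypothesis F_acyclic : acyclic F.

(** If every vertex of [U] had two neighbours in [U], a path in [U] could be prolonged at its head
    for ever, since a neighbour other than the second vertex is either new or closes a cycle. *)
Lemma forest_low_degree (U : {set F}) : U != set0 ->
  exists2 v, v \in U & #|nbr v :&: U| <= 1.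
Proof.
move=> /set0Pn [u0 u0U].
case: (pickP [pred v in U | #|nbr v :&: U| <= 1]) => [v /andP[]|none].
  by exists v.
have deg2 v : v \in U -> 1 < #|nbr v :&: U|.
  by move=> vU; have := none v; rewrite /= vU /= ltnNge => ->.
suff long k : exists v p, [/\ size p = k, uniq (v :: p),
    path (@adj F) v p & all (mem U) (v :: p)].
  have [v [p [sp up _ _]]] := long #|F|.
  by have := max_card (mem (v :: p)); rewrite (card_uniqP up) /= sp ltnn.
elim: k => [|k [v [p [sp up pp /= /andP[vU pU]]]]].
  by exists u0, [::]; rewrite /= u0U.
case: p sp up pp pU => [|w p] sp up pp pU.
  have [y /setIP[]] : exists y, y \in nbr v :&: U.
    by apply/set0Pn; rewrite -card_gt0 ltnW ?deg2.
  rewrite in_nbr => vy yU; exists y, [:: v]; split=> /=.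
  - by rewrite -sp.
  - by rewrite inE; case: eqP vy => // ->; rewrite adj_irrefl.
  - by rewrite adj_sym vy.
  - by rewrite yU vU.
have [y yP yw] : exists2 y, y \in nbr v :&: U & y != w.
  have : nbr v :&: U :\ w != set0.
    rewrite -card_gt0; have := cardsD1 w (nbr v :&: U); have := deg2 _ vU.
    by case: (w \in _) => /=; lia.
  by move=> /set0Pn [y /setD1P[? ?]]; exists y.
move: yP; rewrite inE in_nbr => /andP[vy yU].
have [yp|yp] := boolP (y \in [:: v, w & p]); last first.
  exists y, [:: v, w & p]; split=> //.
  - by rewrite -sp.
  - by apply/andP.
  - by rewrite /= adj_sym vy; move: pp => /= ->.
  - by rewrite /= yU vU; move: pU => /= ->.
have yv : y != v by apply: contraTneq vy => ->; rewrite adj_irrefl.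
(* [y] lies on the path beyond [w], so the initial segment up to [y] has at least three vertices and
   the edge [v y] closes it to a cycle. *)
move: yp; rewrite !inE (negbTE yv) (negbTE yw) /= => yp.
case/splitPr: yp up pp {pU sp} => p1 p2 up pp.
case: (@F_acyclic [:: v, w & rcons p1 y]); first by rewrite /= size_rcons.
apply/andP; split.
  rewrite /cycle /= rcons_path last_rcons [adj y v]adj_sym vy andbT.
  move: pp => /=; rewrite -cat_rcons cat_path => /and3P[-> -> _] //.
move: up; rewrite -cat_rcons -[[:: v, w & _]]/([:: v, w & rcons p1 y] ++ p2).
by rewrite cat_uniq => /andP[].
Qed.

(** Induction on [Y]: a vertex of degree at most 1 in [X :|: Y] must lie in [Y]. It is removed
    together with its neighbour in [X], if there is one; the other vertices of [X] keep their
    degrees. *)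
Lemma forest_expand (X Y : {set F}) : X != set0 -> [disjoint X & Y] ->
  (forall x, x \in X -> 1 < #|nbr x :&: Y|) -> #|X| < #|Y|.
Proof.
have [k] := ubnP #|Y|; elim: k X Y => // k IHk X Y leYk X0 dXY degX.
have [|v /setUP vXY vdeg] := @forest_low_degree (X :|: Y).
  by case/set0Pn: X0 => x xX; apply/set0Pn; exists x; rewrite inE xX.
have sub_deg x (Z : {set F}) : Z \subset X :|: Y ->
    #|nbr x :&: Z| <= #|nbr x :&: (X :|: Y)|.
  by move=> sZ; apply/subset_leq_card/setIS.
have vX : v \notin X.
  apply/negP => vX; have := leq_trans (degX v vX) (sub_deg v _ (subsetUr X Y)).
  by rewrite ltnNge vdeg.
case: vXY => [|vY]; first by rewrite (negbTE vX).
have YE := cardsD1 v Y; rewrite vY in YE.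
have ltYk : #|Y :\ v| < k by lia.
have dXY' (Z : {set F}) : Z \subset X -> [disjoint Z & Y :\ v].
  by move=> sZ; apply: disjointWl sZ _; apply: disjointWr (subD1set _ _) dXY.
have stay x : x \in X -> ~~ adj v x -> 1 < #|nbr x :&: (Y :\ v)|.
  move=> xX vx; rewrite (_ : nbr x :&: (Y :\ v) = nbr x :&: Y) ?degX //.
  apply/setP => z; rewrite !inE; case: eqP => // ->.
  by rewrite adj_sym (negbTE vx).
case: (pickP [pred x in X | adj v x]) => [x /andP[/= xX vx]|none]; last first.
  suff : #|X| < #|Y :\ v| by rewrite YE; lia.
  apply: IHk => //; first exact: dXY'.
  by move=> x xX; apply: stay => //; have := none x; rewrite /= xX /= => ->.
have XE := cardsD1 x X; rewrite xX in XE.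
have [Xx|Xx] := eqVneq (X :\ x) set0.
  rewrite XE Xx cards0; apply: leq_trans (degX x xX) _.
  exact/subset_leq_card/subsetIr.
suff : #|X :\ x| < #|Y :\ v| by rewrite XE YE; lia.
apply: IHk => //; first by apply: dXY'; apply: subD1set.
move=> z /setD1P[zx zX]; apply: stay => //; apply/negP => vz.
move: vdeg; rewrite leqNgt => /negP; apply.
apply: leq_trans (_ : #|[set x; z]| <= _); first by rewrite cards2 eq_sym zx.
by apply/subset_leq_card/subsetP => t; rewrite !inE => /orP[]/eqP->;
  rewrite ?vx ?vz ?xX ?zX.
Qed.

(** Greedy embedding: [v] has at most one neighbour [p] in [U], and the image of [p] has more
    neighbours in [W] than are occupied. All of [F], not only [U], is sent into [W], so that an
    arbitrary [p] will do when [v] has no neighbour in [U]. *)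
Lemma forest_embed (G : sgraph) (W : {set G}) (U : {set F}) : W != set0 ->
  (forall w, w \in W -> #|F| <= #|nbr w :&: W|) ->
  exists f : F -> G, [/\ {in U &, injective f}, forall x, f x \in W
    & {in U &, forall x y, adj x y -> adj (f x) (f y)}].
Proof.
move=> /set0Pn [w0 w0W] degW.
have [k] := ubnP #|U|; elim: k U => // k IHk U leUk.
have [->|U0] := eqVneq U set0.
  by exists (fun=> w0); split=> [x y|//|x y]; rewrite !inE.
have [v vU vdeg] := forest_low_degree U0.
have UE := cardsD1 v U; rewrite vU in UE.
have [|f [f_inj fW f_adj]] := IHk (U :\ v); first by lia.
have [p pP] : exists p, forall y, y \in U -> adj v y -> y = p.
  case: (pickP [pred y in U | adj v y]) => [p /andP[/= pU vp]|none].
    exists p => y yU vy; apply/eqP; apply: contraTT vdeg => yp.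
    rewrite -ltnNge; apply: leq_trans (_ : #|[set y; p]| <= _).
      by rewrite cards2 yp.
    by apply/subset_leq_card/subsetP => t; rewrite !inE => /orP[]/eqP->;
      rewrite ?vp ?vy ?pU ?yU.
  by exists v => y yU vy; have := none y; rewrite /= yU vy.
have [z zN zf] : exists2 z, z \in nbr (f p) :&: W & z \notin f @: (U :\ v).
  apply/subsetPn; apply/negP => /subset_leq_card sub.
  have := leq_trans (degW _ (fW p)) sub; rewrite leqNgt => /negP; apply.
  apply: leq_ltn_trans (leq_imset_card _ _) _.
  by have : #|U| <= #|F| := max_card _; lia.
move: zN; rewrite inE in_nbr => /andP[fpz zW].
exists (fun x => if x == v then z else f x); split=> [x y xU yU|x|x y xU yU].
- case: eqP => [->|/eqP xv]; case: eqP => [->|/eqP yv] // e.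
  + by case/negP: zf; rewrite e imset_f // !inE yv.
  + by case/negP: zf; rewrite -e imset_f // !inE xv.
  + by apply: f_inj => //; rewrite !inE ?xv ?yv.
- by case: eqP.
- case: eqP => [->|/eqP xv]; case: eqP => [->|/eqP yv]; rewrite ?adj_irrefl //.
  + by move=> vy; rewrite (pP y yU vy) adj_sym.
  + by rewrite adj_sym => vx; rewrite (pP x xU vx).
  + by move=> xy; apply: f_adj => //; rewrite !inE ?xv ?yv.
Qed.

End Forest.

(** * Degenerate graphs and weighted edge sums *)

Definition degenerate (G : sgraph) (k : nat) : Prop :=
  forall W : {set G}, W != set0 -> exists2 w, w \in W & #|nbr w :&: W| <= k.

Lemma forest_free_degenerate (F G : sgraph) :
  acyclic F -> ~ contains G F -> degenerate G #|F|.
Proof.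
move=> F_acyclic Gfree W W0.
case: (pickP [pred w in W | #|nbr w :&: W| <= #|F|]) => [w /andP[]|none].
  by exists w.
case: Gfree; have [|f [f_inj _ f_adj]] := @forest_embed F F_acyclic G W setT W0.
  by move=> w wW; have := none w; rewrite /= wW /= => /negbT; rewrite -ltnNge => /ltnW.
by exists f => [x y|x y]; [apply: f_inj | apply: f_adj]; rewrite inE.
Qed.

Section DegenerateForm.
Local Open Scope ring_scope.

(** Peeling off a vertex [w] of low degree costs its at most [k] edges inside [U], each seen from
    both ends and of weight at most [m * x w]. Constant weights give the edge count; small weights
    bound the loss when edges are rewired. *)
Lemma degenerate_form (R : realDomainType) (G : sgraph) (k : nat)
    (x : G -> R) (m : R) (U : {set G}) :
  degenerate G k -> (forall u, 0 <= x u) -> (forall u, u \in U -> x u <= m) ->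
  \sum_(u in U) x u * (\sum_(v in nbr u :&: U) x v)
    <= (2 * k)%:R * m * \sum_(u in U) x u.
Proof.
move=> G_deg x_ge0; have [c] := ubnP #|U|; elim: c U => // c IHc U leUc x_le.
have [->|U0] := eqVneq U set0; first by rewrite !big_set0 mulr0.
have [w wU wdeg] := G_deg _ U0.
have UE := cardsD1 w U; rewrite wU in UE.
have m_ge0 : 0 <= m := le_trans (x_ge0 w) (x_le w wU).
have split_nbr u : u \in U -> \sum_(v in nbr u :&: U) x v =
   (adj u w)%:R * x w + \sum_(v in nbr u :&: (U :\ w)) x v.
  move=> uU; have -> : nbr u :&: (U :\ w) = (nbr u :&: U) :\ w.
    by apply/setP => z; rewrite !inE andbCA.
  have [uw|uw] := boolP (adj u w).
    by rewrite (big_setD1 w) ?mul1r //= !inE uw wU.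
  rewrite mul0r add0r; apply: eq_bigl => z; rewrite !inE.
  by case: eqP => //= ->; rewrite (negbTE uw).
have IH : \sum_(u in U :\ w) x u * (\sum_(v in nbr u :&: (U :\ w)) x v)
    <= (2 * k)%:R * m * \sum_(u in U :\ w) x u.
  by apply: IHc; [lia | move=> u /setD1P[_ /x_le]].
have Nw : \sum_(v in nbr w :&: U) x v <= k%:R * m.
  apply: le_trans (_ : \sum_(v in nbr w :&: U) m <= _).
    by apply: ler_sum => v /setIP[_ /x_le].
  by rewrite sumr_const -[m *+ _]mulr_natl ler_wpM2r // ler_nat.
have back : \sum_(u in U :\ w) x u * ((adj u w)%:R * x w)
   = x w * \sum_(v in nbr w :&: U) x v.
  rewrite (split_nbr w wU) adj_irrefl mul0r add0r mulr_sumr.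
  rewrite [RHS]big_mkcond [LHS]big_mkcond; apply: eq_bigr => u _.
  rewrite !inE [adj u w]adj_sym; case: (u == w); case: (u \in U) => //=;
  case: (adj w u) => //=; rewrite ?andbF ?mul0r ?mulr0 ?mul1r //.
  by rewrite mulrC.
rewrite (big_setD1 w) //= [X in _ <= _ * X](big_setD1 w) //= mulrDr.
have -> : \sum_(u in U :\ w) x u * (\sum_(v in nbr u :&: U) x v) =
   x w * \sum_(v in nbr w :&: U) x v +
   \sum_(u in U :\ w) x u * (\sum_(v in nbr u :&: (U :\ w)) x v).
  rewrite -back -big_split /=; apply: eq_bigr => u /setD1P[_ uU].
  by rewrite split_nbr // mulrDr.
rewrite addrA; apply: lerD => //.
rewrite -mulrDr [X in _ <= X]mulrC; apply: ler_wpM2l => //.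
by rewrite mul2n -addnn natrD mulrDl; apply: lerD.
Qed.

Lemma degenerate_degree_sum (G : sgraph) (k : nat) (U : {set G}) :
  degenerate G k -> (\sum_(u in U) #|nbr u :&: U| <= 2 * k * #|U|)%N.
Proof.
move=> G_deg; have := @degenerate_form int G k (fun=> 1) 1 U G_deg.
move=> /(_ (fun _ => ler01)) /(_ (fun _ _ => lexx 1)).
rewrite sumr_const mulr1 -natrM -(ler_nat int) natr_sum; apply: le_trans.
by apply: ler_sum => u _; rewrite mul1r sumr_const.
Qed.

End DegenerateForm.

(** * Isomorphism, embeddings and vertex covers *)

Lemma iso_sym (G H : sgraph) : iso G H -> iso H G.
Proof.
case=> f [g fK gK] f_adj; exists g; first by exists f.
by move=> x y; rewrite -f_adj !gK.
Qed.

Lemma iso_card (G H : sgraph) : iso G H -> #|G| = #|H|.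
Proof. by case=> f f_bij _; apply: bij_eq_card f_bij. Qed.

Lemma iso_trans (G H K : sgraph) : iso G H -> iso H K -> iso G K.
Proof.
case=> f f_bij f_adj [g g_bij g_adj]; exists (g \o f).
  exact: bij_comp.
by move=> x y; rewrite /= g_adj f_adj.
Qed.

Lemma contains_isol (G G' H : sgraph) :
  iso G G' -> contains G H -> contains G' H.
Proof.
case=> f f_bij f_adj [g g_inj g_adj]; exists (f \o g).
  exact: inj_comp (bij_inj f_bij) g_inj.
by move=> x y xy; rewrite /= f_adj g_adj.
Qed.

Lemma contains_isor (G H H' : sgraph) :
  iso H H' -> contains G H -> contains G H'.
Proof.
case/iso_sym=> f f_bij f_adj [g g_inj g_adj]; exists (g \o f).
  exact: inj_comp g_inj (bij_inj f_bij).
by move=> x y xy; rewrite /= g_adj // f_adj.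
Qed.

Section RhoIso.
Local Open Scope ring_scope.

Lemma rhoR_iso_le (G H : sgraph) : (0 < #|G|)%N -> iso G H -> rhoR G <= rhoR H.
Proof.
move=> G_gt0 [f [g fK gK] f_adj].
have [x [xE x_ge0 [u xu]]] := perron_fun G_gt0.
apply: (@eigenfun_le_rho H _ (x \o g)); last first.
  by exists (f u); rewrite /= fK gt_eqF.
move=> w /=; rewrite -xE (reindex f) /=; last by exists g => z _.
by apply: eq_big => v; [rewrite -f_adj gK | rewrite fK].
Qed.

Lemma rhoR_iso (G H : sgraph) : (0 < #|G|)%N -> iso G H -> rhoR G = rhoR H.
Proof.
move=> G_gt0 isoGH; apply/le_anti/andP; split; apply: rhoR_iso_le => //.
  by rewrite -(iso_card isoGH).
exact: iso_sym.
Qed.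

Lemma SPEX_iso n (F G H : sgraph) : (0 < n)%N -> iso G H -> SPEX n F G -> SPEX n F H.
Proof.
move=> n_gt0 isoGH [Gn Gfree Gmax]; split.
- by rewrite -(iso_card isoGH).
- by move/(contains_isol (iso_sym isoGH)).
move=> G' G'n G'free.
have : rhoR G' <= rhoR G by exact: Gmax.
by rewrite (rhoR_iso _ isoGH) // Gn.
Qed.

(** A boolean form, so that an [F]-free graph of maximal radius can be selected by [arg_maxP]. *)
Definition containsb (G H : sgraph) : bool :=
  [exists f : {ffun H -> G}, injectiveb f &&
    [forall x, forall y, adj x y ==> adj (f x) (f y)]].

Lemma containsP (G H : sgraph) : reflect (contains G H) (containsb G H).
Proof.
apply: (iffP existsP) => [[f /andP[/injectiveP f_inj /'forall_forallP f_adj]]|].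
  by exists f => // x y; apply/implyP.
case=> f f_inj f_adj; exists [ffun x => f x]; apply/andP; split.
  by apply/injectiveP => x y; rewrite !ffunE => /f_inj.
by apply/'forall_forallP => x y; rewrite !ffunE; apply/implyP/f_adj.
Qed.

Section OrdGraph.
Variables (n : nat) (e : {set 'I_n * 'I_n}).
(** Symmetrized and cut off the diagonal, so that every set [e] gives a graph. Up to isomorphism
    these finitely many graphs are all graphs of order [n], which makes a maximum of the radius
    exist. *)
Definition ord_adj : rel 'I_n :=
  fun i j => (i != j) && (((i, j) \in e) || ((j, i) \in e)).
Fact ord_adj_sym : symmetric ord_adj.
Proof. by move=> i j; rewrite /ord_adj eq_sym orbC. Qed.
Fact ord_adj_irrefl : irreflexive ord_adj.
Proof. by move=> i; rewrite /ord_adj eqxx. Qed.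
Definition ord_graph : sgraph := SGraph ord_adj_sym ord_adj_irrefl.
End OrdGraph.

Lemma ord_graph_iso n (G : sgraph) : #|G| = n ->
  exists e : {set 'I_n * 'I_n}, iso G (ord_graph e).
Proof.
move=> Gn; subst n.
exists [set p | adj (@enum_val G G p.1) (enum_val p.2)].
exists (@enum_rank G); first exact: enum_rank_bij.
move=> x y; rewrite /= /ord_adj !inE /= !enum_rankK (adj_sym y x) orbb.
rewrite (inj_eq enum_rank_inj); case: eqP => //= ->.
by rewrite adj_irrefl.
Qed.

Lemma SPEX_exists n (F : sgraph) (G0 : sgraph) : (0 < n)%N ->
  #|G0| = n -> ~ contains G0 F -> exists G, SPEX n F G.
Proof.
move=> n_gt0 G0n G0free; have [e0 iso0] := ord_graph_iso G0n.
pose P (e : {set 'I_n * 'I_n}) := ~~ containsb (ord_graph e) F.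
have P0 : P e0.
  by apply/containsP => /(contains_isol (iso_sym iso0)).
have [e /containsP e_free e_max] :=
  @arg_maxP _ _ _ e0 P (fun e => rhoR (ord_graph e)) P0.
exists (ord_graph e); split=> //; first by rewrite /= card_ord.
move=> G Gn Gfree; have [e' iso'] := ord_graph_iso Gn.
suff : rhoR G <= rhoR (ord_graph e) by [].
rewrite (rhoR_iso _ iso') ?Gn //; apply: e_max.
by apply/containsP => /(contains_isol (iso_sym iso')).
Qed.

End RhoIso.

Lemma cover_out (F : sgraph) (S : {set F}) x y :
  vertex_cover S -> adj x y -> x \notin S -> y \in S.
Proof.
by move=> /'forall_forallP/(_ x y)/implyP cS xy /negbTE xS; have := cS xy; rewrite xS.
Qed.

Lemma vertex_coverI (F : sgraph) (S : {set F}) :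
  (forall x y, adj x y -> x \notin S -> y \in S) -> vertex_cover S.
Proof.
move=> cS; apply/'forall_forallP => x y; apply/implyP => xy.
by have [|/(cS _ _ xy) ->] := boolP (x \in S); rewrite ?orbT.
Qed.

Lemma beta_le (F : sgraph) (S : {set F}) : vertex_cover S -> beta F <= #|S|.
Proof.
have vT : vertex_cover [set: F] by apply: vertex_coverI => x y _; rewrite !inE.
by move=> cS; rewrite /beta; case: arg_minnP => // C _; apply.
Qed.

Lemma beta_attained (F : sgraph) : exists2 S : {set F}, vertex_cover S & #|S| = beta F.
Proof.
have vT : vertex_cover [set: F] by apply: vertex_coverI => x y _; rewrite !inE.
by rewrite /beta; case: arg_minnP => // C cC _; exists C.
Qed.

(** Vertices outside a cover are pairwise nonadjacent, so they may be scattered over [R]. Only those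
    [s] with a neighbour outside [S] have to see [R]; this freedom lets a leaf be placed at a vertex
    that does not. *)
Lemma embed_extend (F G : sgraph) (S : {set F}) (g : F -> G) (R : {set G}) :
  vertex_cover S -> {in S &, injective g} ->
  {in S &, forall x y, adj x y -> adj (g x) (g y)} ->
  #|F| <= #|R| -> (forall s, s \in S -> g s \notin R) ->
  (forall s x, s \in S -> x \notin S -> adj s x ->
    forall r, r \in R -> adj (g s) r) ->
  contains G F.
Proof.
move=> cS g_inj g_adj leFR gR g_ext.
pose r x := enum_val (widen_ord leFR (enum_rank x)).
have rR x : r x \in R by apply: enum_valP.
have r_inj : injective r.
  move=> x y /enum_val_inj e; apply/enum_rank_inj/val_inj.
  by have /(congr1 val) := e.
exists (fun x => if x \in S then g x else r x) => x y.
  case: ifP => xS; case: ifP => yS; first exact: g_inj.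
  - by move=> e; case/negP: (gR x xS); rewrite e.
  - by move=> e; case/negP: (gR y yS); rewrite -e.
  - exact: r_inj.
case: ifP => xS; case: ifP => yS xy; first exact: g_adj.
- by apply: g_ext xy _ _; rewrite ?yS.
- by rewrite adj_sym; apply: (g_ext y x) => //; rewrite ?xS // adj_sym.
- by have := cover_out cS xy (negbT xS); rewrite yS.
Qed.

Definition common (G : sgraph) (L : {set G}) : {set G} :=
  [set r | L \subset nbr r].

Lemma in_common (G : sgraph) (L : {set G}) r l :
  r \in common L -> l \in L -> adj l r.
Proof. by rewrite inE => /subsetP sL /sL; rewrite in_nbr adj_sym. Qed.

Lemma notin_common (G : sgraph) (L : {set G}) l : l \in L -> l \notin common L.
Proof. by move=> lL; apply/negP => /in_common/(_ lL); rewrite adj_irrefl. Qed.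

Lemma embed_common (F G : sgraph) (S : {set F}) (g : F -> G) (L : {set G}) :
  vertex_cover S -> {in S &, injective g} -> (forall s, s \in S -> g s \in L) ->
  {in S &, forall x y, adj x y -> adj (g x) (g y)} ->
  #|F| <= #|common L| -> contains G F.
Proof.
move=> cS g_inj gL g_adj leF; apply: (embed_extend cS g_inj g_adj leF).
  by move=> s sS; rewrite notin_common ?gL.
by move=> s x sS _ _ r rR; apply: in_common rR (gL s sS).
Qed.

Lemma inj_on_exists (T T' : finType) (X : {set T}) (Y : {set T'}) :
  #|X| <= #|Y| -> forall t0 : T', exists g : T -> T',
    {in X &, injective g} /\ forall x, x \in X -> g x \in Y.
Proof.
move=> leXY t0; exists (fun x => nth t0 (enum Y) (index x (enum X))).
split=> [x y xX yX|x xX].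
  have lt z : z \in X -> index z (enum X) < size (enum Y).
    by move=> zX; rewrite -cardE (leq_trans _ leXY) // cardE index_mem mem_enum.
  move=> /eqP; rewrite nth_uniq ?enum_uniq ?lt // => /eqP e.
  by have := congr1 (nth x (enum X)) e; rewrite !nth_index ?mem_enum.
by rewrite -mem_enum mem_nth // -cardE (leq_trans _ leXY) // cardE index_mem mem_enum.
Qed.

Lemma common_small (F G : sgraph) (A : {set F}) (L : {set G}) :
  vertex_cover A -> independent A -> ~ contains G F -> #|A| <= #|L| ->
  #|common L| < #|F|.
Proof.
move=> cA iA Gfree leAL; rewrite ltnNge; apply/negP => leF; apply: Gfree.
have [/eqP L0|] := posnP #|common L|.
  have F0 : #|F| = 0 by lia.
  have nF (x : F) : False by have := fintype0 x F0.
  by exists (fun x => False_rect _ (nF x)) => x; case: (nF x).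
move=> /card_gt0P [t0 _].
have [g [g_inj gL]] := inj_on_exists leAL t0.
apply: (embed_common cA g_inj gL) => // x y xA yA xy.
by move: iA => /forallP/(_ x)/implyP/(_ xA)/forallP/(_ y)/implyP/(_ yA); rewrite xy.
Qed.

Section Cone.
Variables (T : finType) (L : {set T}) (e : rel T).
Hypotheses (e_sym : symmetric e) (e_irrefl : irreflexive e).
(** The join of [(L, e)] with an independent set, kept on the given vertex set so that one weight
    function lives on both graphs. [e] is the adjacency of [G] or one pulled back from a competitor
    of [G[L]]. *)
Definition cone_adj : rel T := fun u v =>
  if u \in L then (v \in L) ==> e u v else v \in L.
Fact cone_sym : symmetric cone_adj.
Proof.
by move=> u v; rewrite /cone_adj; case: (u \in L); case: (v \in L); rewrite //= e_sym.
Qed.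
Fact cone_irrefl : irreflexive cone_adj.
Proof. by move=> u; rewrite /cone_adj; case: (u \in L) => //=. Qed.
Definition cone : sgraph := SGraph cone_sym cone_irrefl.

Lemma contains_cone (F : sgraph) (f : F -> cone) : injective f ->
  (forall x y, adj x y -> adj (f x) (f y)) ->
  [/\ vertex_cover (f @^-1: L), #|f @^-1: L| <= #|L| &
    {in f @^-1: L &, forall x y, adj x y -> e (f x) (f y)}].
Proof.
move=> f_inj f_adj; split.
- apply: vertex_coverI => x y /f_adj; rewrite !inE /= /cone_adj => + /negbTE fx.
  by rewrite fx.
- rewrite -(card_imset _ f_inj); apply/subset_leq_card/subsetP => _ /imsetP[x + ->].
  by rewrite inE.
- by move=> x y; rewrite !inE => fx fy /f_adj; rewrite /= /cone_adj fx fy.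
Qed.
End Cone.

Lemma join_contains_cover (F Q : sgraph) m : contains (join Q (edgeless m)) F ->
  exists S : {set F}, [/\ vertex_cover S, #|S| <= #|Q| & contains Q (induced S)].
Proof.
case=> f f_inj f_adj; pose S := [set x | if f x is inl _ then true else false].
have fS (x : F) : x \in S -> {y | f x = inl y}.
  by rewrite inE; case: (f x) => // y _; exists y.
pose g (x : induced S) : Q := sval (fS _ (valP x)).
have gE x : f (val x) = inl (g x) by rewrite /g; case: (fS _ _).
have g_inj : injective g.
  by move=> x y e; apply/val_inj/f_inj; rewrite !gE e.
exists S; split.
- apply: vertex_coverI => x y /f_adj; rewrite !inE.
  by case: (f x) => //; case: (f y).
- by rewrite -card_sig; apply: leq_card g_inj.
- by exists g => // x y xy; have := f_adj _ _ xy; rewrite !gE.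
Qed.

Lemma cover_join_contains (F Q : sgraph) m (S : {set F}) :
  vertex_cover S -> contains Q (induced S) -> #|F| <= m ->
  contains (join Q (edgeless m)) F.
Proof.
move=> cS [g g_inj g_adj] leFm.
have [m0|m_gt0] := posnP m.
  have nF (x : F) : False by apply: (fintype0 x); lia.
  by exists (fun x => False_rect _ (nF x)) => x; case: (nF x).
pose h (x : F) : join Q (edgeless m) :=
  if @idP (x \in S) is ReflectT xS then inl (g (exist _ x xS)) else inr (Ordinal m_gt0).
have hE x (xS : x \in S) : h x = inl (g (exist _ x xS)).
  rewrite /h; case: {-}_ / idP => // xS'; congr (inl (g _)); exact/val_inj.
apply: (@embed_extend F (join Q (edgeless m)) S h [set inr x | x in 'I_m] cS).
- move=> x y xS yS; rewrite (hE _ xS) (hE _ yS) => -[/g_inj e].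
  by have /(congr1 val) := e.
- by move=> x y xS yS xy; rewrite (hE _ xS) (hE _ yS); apply: g_adj.
- by rewrite card_imset ?card_ord // => ? ? [].
- by move=> s sS; rewrite (hE _ sS); apply/imsetP => -[].
- by move=> s x sS _ _ r /imsetP[i _ ->]; rewrite (hE _ sS).
Qed.

(** If [beta F = q.+1], both sides hold outright: the complete graph on [q.+1] vertices is too large
    for [Q], and no cover of [F] fits into [Q]. Otherwise the vertices of a copy of [F] that lie in
    [Q] form a cover, and conversely an embedded cover extends into the [m] isolated vertices. *)
Lemma family_freeP (F Q : sgraph) (q m : nat) :
  beta F <= q.+1 -> #|Q| = q -> #|F| <= m ->
  family_free (cover_family F q) Q <-> ~ contains (join Q (edgeless m)) F.
Proof.
move=> leb Qq leFm; split=> [Qfree /join_contains_cover [S [cS leS Qs]]|Gfree H].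
  rewrite Qq in leS; apply: (Qfree (induced S) _ Qs).
  rewrite /cover_family; case: eqP => [b|_]; first by have := beta_le cS; lia.
  by exists S; split=> //; exists id; first exists id.
rewrite /cover_family; case: eqP => [_ HK|_ [S [cS leS HS]]] QH.
  have [f /leq_card] := contains_isor HK QH.
  by rewrite Qq /= card_ord ltnn.
by apply/Gfree/(cover_join_contains cS) => //; apply: contains_isor HS QH.
Qed.

(** * Bipartitions, degrees and added edges *)

Lemma independentP (G : sgraph) (S : {set G}) :
  reflect {in S &, forall x y, ~~ adj x y} (independent S).
Proof.
apply: (iffP forall_inP) => [iS x y xS yS|iS x xS].
  by have /forall_inP/(_ y yS) := iS x xS.
by apply/forall_inP => y yS; apply: iS.
Qed.

Lemma partite_cover (F : sgraph) (A B : {set F}) :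
  partite_sets A B -> vertex_cover A.
Proof.
case=> AB _ _ /independentP iB; apply: vertex_coverI => x y xy xA.
have inB z : z \notin A -> z \in B.
  by have := in_setT z; rewrite -AB inE => /orP[->|].
by apply: contraT => yA; have := iB x y (inB _ xA) (inB _ yA); rewrite xy.
Qed.

(** An independent cover is a colour class of a proper 2-colouring. Whether two such colourings
    agree does not change along an edge. *)
Lemma connected_colouring (F : sgraph) (S A : {set F}) :
  (forall x y : F, connect (@adj F) x y) ->
  independent S -> vertex_cover S -> independent A -> vertex_cover A ->
  S = A \/ S = ~: A.
Proof.
move=> F_conn /independentP iS cS /independentP iA cA.
have flip (C : {set F}) x y : {in C &, forall x y, ~~ adj x y} ->
    vertex_cover C -> adj x y -> (y \in C) = (x \notin C).
  move=> iC cC xy; apply/idP/idP => [yC|]; last exact: cover_out.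
  by apply/negP => xC; have := iC x y xC yC; rewrite xy.
have [x0 _|F0] := pickP (mem F); last first.
  by left; apply/setP => x; have := F0 x.
pose c x := (x \in S) == (x \in A).
have cE x : c x = c x0.
  have /connectP[p pp ->] := F_conn x0 x.
  elim: p x0 pp {x} => //= y p IHp x /andP[xy /IHp ->].
  by rewrite /c (flip _ _ _ iS cS xy) (flip _ _ _ iA cA xy); do 2!case: (x \in _).
have [c0|c0] := boolP (c x0); [left|right]; apply/setP => x.
  by apply/eqP; rewrite -/(c x) cE.
rewrite inE; have := cE x; rewrite (negbTE c0) /c.
by do 2!case: (x \in _).
Qed.

Lemma tree_cover_independent (F : sgraph) (A B S : {set F}) :
  is_tree F -> partite_sets A B -> #|A| <= #|B| ->
  independent S -> vertex_cover S -> #|A| <= #|S|.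
Proof.
move=> [_ F_conn _] AB leAB iS cS; have cA := partite_cover AB.
have [AB1 dAB iA iB] := AB.
case: (connected_colouring F_conn iS cS iA cA) => -> //.
apply: leq_trans leAB (subset_leq_card _); apply/subsetP => x xB.
by rewrite inE; move: dAB; rewrite disjoint_sym => /disjointFr ->.
Qed.

Lemma complete_bipartite_iso q m :
  iso (complete_bipartite q m) (join (edgeless q) (edgeless m)).
Proof. by exists id; [exists id | case=> x [] y]. Qed.

Lemma edgeless_join_free (F : sgraph) (A B : {set F}) q m :
  is_tree F -> partite_sets A B -> #|A| <= #|B| -> q < #|A| ->
  ~ contains (join (edgeless q) (edgeless m)) F.
Proof.
move=> F_tree AB leAB ltq /join_contains_cover [S [cS leS [f f_inj f_adj]]].
suff iS : independent S.
  have := tree_cover_independent F_tree AB leAB iS cS.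
  by move: leS; rewrite /= card_ord; lia.
apply/independentP => x y xS yS; apply/negP => xy.
by have := f_adj (exist _ x xS) (exist _ y yS) xy.
Qed.

Lemma tree_deg_gt0 (F : sgraph) (x : F) : is_tree F -> 1 < #|F| -> 0 < deg x.
Proof.
case=> _ F_conn _ F_gt1; have : [set~ x] != set0.
  by rewrite -card_gt0 cardsC1; lia.
case/set0Pn=> y; rewrite !inE => yx.
have /connectP [p] := F_conn x y.
case: p => [|z p] /=; first by move=> _ yE; rewrite yE eqxx in yx.
by case/andP=> xz _ _; apply/card_gt0P; exists z; rewrite inE.
Qed.

Lemma min_deg_in_le (F : sgraph) (A : {set F}) x :
  x \in A -> min_deg_in A <= deg x.
Proof.
move=> xA; rewrite /min_deg_in; have := mem_index_enum x.
elim: (index_enum F) => // y s IHs; rewrite big_cons inE => /orP[/eqP <-|/IHs le].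
  by rewrite xA geq_minl.
by case: ifP => // _; rewrite geq_min le orbT.
Qed.

Lemma deg_lt (F : sgraph) (x : F) : deg x < #|F|.
Proof.
have : [set y | adj x y] \subset [set~ x].
  by apply/subsetP => y; rewrite !inE; apply: contraTneq => ->; rewrite adj_irrefl.
move=> /subset_leq_card; rewrite cardsC1 -/(deg x).
by have : 0 < #|F| by [apply/card_gt0P; exists x]; lia.
Qed.

Lemma min_deg_in_attained (F : sgraph) (A : {set F}) :
  A != set0 -> exists2 x, x \in A & deg x = min_deg_in A.
Proof.
case/set0Pn=> x0 x0A; case: (@arg_minnP _ x0 (mem A) (@deg F) x0A) => x xA x_min.
exists x => //; apply/eqP; rewrite eqn_leq min_deg_in_le // andbT.
rewrite /min_deg_in; elim/big_ind: _ => [|m n|y yA]; last exact: x_min.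
  exact/ltnW/deg_lt.
by rewrite leq_min => -> ->.
Qed.

Section NoLeaf.
Variables (F : sgraph) (A B : {set F}).
Hypotheses (F_acyclic : acyclic F) (AB : partite_sets A B).
Hypothesis deg2 : forall x, x \in A -> 1 < deg x.

(** All neighbours of a vertex of [A :\: C] lie in [C :\: A], at least two for each, so expansion
    would make [C] larger than [A]. *)
Lemma no_leaf_cover (C : {set F}) : vertex_cover C -> #|C| <= #|A| -> C = A.
Proof.
move=> cC leC; have [_ _ /independentP iA _] := AB.
suff sA : A \subset C by apply/eqP; rewrite eq_sym eqEcard sA.
rewrite -setD_eq0; apply: contraLR leC => X0; rewrite -ltnNge.
have sN x : x \in A :\: C -> nbr x \subset C :\: A.
  case/setDP=> xA xC; apply/subsetP => y; rewrite in_nbr !inE => xy.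
  rewrite (cover_out cC xy xC) andbT; apply/negP => yA.
  by have := iA x y xA yA; rewrite xy.
have : #|A :\: C| < #|C :\: A|.
  apply: (forest_expand F_acyclic X0) => [|x xX].
    rewrite -setI_eq0; apply/eqP/setP => z; rewrite !inE.
    by case: (z \in A); case: (z \in C).
  by rewrite (setIidPl (sN x xX)) deg2 //; case/setDP: xX.
have := cardsID C A; have := cardsID A C; rewrite setIC; lia.
Qed.

End NoLeaf.

Section AddEdge.
Variables (G : sgraph) (u v : G).
Definition add_edge_adj : rel G := fun x y =>
  adj x y || ((u != v) && (((x, y) == (u, v)) || ((x, y) == (v, u)))).
Fact add_edge_sym : symmetric add_edge_adj.
Proof.
move=> x y; rewrite /add_edge_adj adj_sym !xpair_eqE.
by rewrite [(y == u) && _]andbC [(y == v) && _]andbC [X in _ && X]orbC.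
Qed.
Fact add_edge_irrefl : irreflexive add_edge_adj.
Proof.
move=> x; rewrite /add_edge_adj adj_irrefl !xpair_eqE /=.
rewrite [(x == v) && _]andbC orbb; case: (eqVneq u v) => //= uv.
by have [->|//] := eqVneq x u; rewrite (negbTE uv).
Qed.
Definition add_edge : sgraph := SGraph add_edge_sym add_edge_irrefl.
End AddEdge.

Section AddEdgeRho.
Local Open Scope ring_scope.

Lemma sum_add_edge (G : sgraph) (u v w : G) (x : G -> algR) :
  u != v -> ~~ adj u v ->
  \sum_(z | adj (w : add_edge u v) z) x z =
   \sum_(z | adj w z) x z + (w == u)%:R * x v + (w == v)%:R * x u.
Proof.
move=> uv nuv; have nvu : ~~ adj v u by rewrite adj_sym.
rewrite (bigID (fun z => adj w z)) /= -addrA; congr (_ + _).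
  by apply: eq_bigl => z; rewrite /add_edge_adj; case: adj; rewrite ?andbF ?andbT.
have [->|wu] := eqVneq w u.
  rewrite (negbTE uv) mul0r addr0 mul1r (big_pred1 v) // => z /=.
  rewrite /add_edge_adj uv !xpair_eqE eqxx (negbTE uv) /= orbF.
  by have [->|] := eqVneq z v; [rewrite (negbTE nuv) | case: adj].
have [->|wv] := eqVneq w v.
  rewrite mul0r mul1r add0r (big_pred1 u) // => z /=.
  rewrite /add_edge_adj uv !xpair_eqE eqxx eq_sym (negbTE uv) /=.
  by have [->|] := eqVneq z u; [rewrite (negbTE nvu) | case: adj].
rewrite !mul0r add0r big_pred0 // => z.
by rewrite /add_edge_adj !xpair_eqE (negbTE wu) (negbTE wv) /= andbF orbF andbN.
Qed.

(* A Perron vector of a graph of maximal radius also is one for the larger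
   graph, so it vanishes at the ends of the new edge. *)
Lemma add_edge_rho (G : sgraph) (u v : G) (x : G -> algR) :
  u != v -> ~~ adj u v -> eigenfun (rhoR G) x -> (forall w, 0 <= x w) ->
  rhoR (add_edge u v) <= rhoR G -> x v = 0.
Proof.
move=> uv nuv xE x_ge0 le.
have sumE w : \sum_(z | adj (w : add_edge u v) z) x z =
    rhoR G * x w + (w == u)%:R * x v + (w == v)%:R * x u.
  by rewrite sum_add_edge // xE.
have formE : \sum_w x w * (\sum_(z | adj (w : add_edge u v) z) x z) =
    rhoR G * (\sum_w x w ^+ 2) + x u * x v + x v * x u.
  rewrite mulr_sumr; under eq_bigr do rewrite sumE !mulrDr.
  rewrite !big_split /=; congr (_ + _ + _).
  - by apply: eq_bigr => w _; rewrite mulrCA expr2.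
  - rewrite (bigD1 u) //= eqxx mul1r big1 ?addr0 // => w /negbTE ->.
    by rewrite mul0r mulr0.
  - rewrite (bigD1 v) //= eqxx mul1r big1 ?addr0 // => w /negbTE ->.
    by rewrite mul0r mulr0.
have ss_ge0 : 0 <= \sum_w x w ^+ 2 by apply: sumr_ge0 => w _; apply: sqr_ge0.
have xuv : 0 <= x u * x v by apply: mulr_ge0.
have xE' : eigenfun (rhoR (add_edge u v)) (x : add_edge u v -> algR).
  apply: rayleigh_eq; apply: le_trans (ler_wpM2r ss_ge0 le) _.
  by rewrite formE -addrA lerDl addr_ge0 // mulrC.
have := xE' u; rewrite sumE eqxx (negbTE uv) mul1r mul0r addr0 => e.
apply/le_anti; rewrite x_ge0 andbT.
by rewrite -(lerD2l (rhoR G * x u)) addr0 e ler_wpM2r.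
Qed.
End AddEdgeRho.

(** In a copy of [F], the preimage [S] of [Q] becomes a cover once the preimage of either end of the
    new edge is added. Both covers have size at most [#|A|], so both equal [A], and their
    intersection [S] equals [A] although it is too small. *)
Lemma no_leaf_add_edge_free (F Q : sgraph) (A B : {set F}) m (i j : 'I_m) :
  acyclic F -> partite_sets A B -> (forall x, x \in A -> 1 < deg x) ->
  #|Q| < #|A| -> i != j ->
  ~ contains (@add_edge (join Q (edgeless m)) (inr i) (inr j)) F.
Proof.
move=> F_acyclic AB deg2 ltQ ij [f f_inj f_adj].
pose S := [set x | if f x is inl _ then true else false].
have leS : #|S| <= #|Q|.
  have -> : #|Q| = #|[set @inl Q 'I_m y | y in Q]|.
    by rewrite card_imset // => ? ? [].
  rewrite -(card_imset _ f_inj); apply/subset_leq_card/subsetP.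
  move=> _ /imsetP [x + ->]; rewrite inE; case: (f x) => // y _.
  by rewrite imset_f.
have cardU k : #|S :|: [set x | f x == inr k]| <= #|A|.
  apply: leq_trans (leq_card_setU _ _) _.
  suff : #|[set x | f x == inr k]| <= 1 by lia.
  apply/card_le1_eqP => x y; rewrite !inE => /eqP fx /eqP fy.
  by apply: f_inj; rewrite fx fy.
have SE : S = A.
  have Ai : S :|: [set x | f x == inr i] = A.
    apply: (no_leaf_cover F_acyclic AB deg2 _ (cardU i)).
    apply: vertex_coverI => x y /f_adj; rewrite !inE /= /add_edge_adj.
    case: (f x) => [a|a]; case: (f y) => [b|b] //=; rewrite !xpair_eqE /=.
    by case/andP=> _ /orP[/andP[-> _]|/andP[_ ->]].
  have Aj : S :|: [set x | f x == inr j] = A.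
    apply: (no_leaf_cover F_acyclic AB deg2 _ (cardU j)).
    apply: vertex_coverI => x y /f_adj; rewrite !inE /= /add_edge_adj.
    case: (f x) => [a|a]; case: (f y) => [b|b] //=; rewrite !xpair_eqE /=.
    by case/andP=> _ /orP[/andP[_ ->]|/andP[-> _]].
  rewrite -[RHS]setIid -{1}Ai -Aj -setUIr.
  suff -> : [set x | f x == inr i] :&: [set x | f x == inr j] = set0.
    by rewrite setU0.
  apply/setP => x; rewrite !inE; apply/andP => -[/eqP -> /eqP[e]].
  by rewrite e eqxx in ij.
by move: leS; rewrite SE; lia.
Qed.

(** Maximality against the graph with the extra edge forces [x (inr j) = 0]. The eigenvector
    equation at [inr j] spreads the zero to [Q], and at [inl y0] to the remaining vertices. *)
Lemma no_leaf_not_SPEX (F Q : sgraph) (A B : {set F}) n m :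
  acyclic F -> partite_sets A B -> (forall x, x \in A -> 1 < deg x) ->
  #|Q| < #|A| -> 0 < #|Q| -> 1 < m -> ~ SPEX n F (join Q (edgeless m)).
Proof.
move=> F_acyclic AB deg2 ltQ /card_gt0P [y0 _] m_gt1 [Gn _ Gmax].
set G := join Q (edgeless m) in Gn Gmax *.
pose i : 'I_m := Ordinal (ltnW m_gt1); pose j : 'I_m := Ordinal m_gt1.
have ij : i != j by [].
have [|x [xE x_ge0 [u xu]]] := @perron_fun G.
  by apply/card_gt0P; exists (inl y0).
have xj : x (inr j) = 0%R.
  apply: (@add_edge_rho G (inr i) (inr j) x) => //.
  by apply: Gmax; [| apply: no_leaf_add_edge_free AB _ _ _].
have xQ y : x (inl y) = 0%R.
  have := xE (inr j); rewrite xj mulr0 => /eqP.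
  rewrite psumr_eq0 => [/allP/(_ (inl y))|? _]; last exact: x_ge0.
  by rewrite mem_index_enum => /(_ isT) /implyP /(_ isT) /eqP.
case: u xu => [y|k] xu; first by rewrite xQ ltxx in xu.
have /eqP := xE (inl y0); rewrite xQ mulr0.
rewrite psumr_eq0 => [/allP/(_ (inr k))|? _]; last exact: x_ge0.
rewrite mem_index_enum => /(_ isT) /implyP /(_ isT) /eqP e.
by rewrite e ltxx in xu.
Qed.

(** * Localization of the Perron vector *)

Section Localization.
Local Open Scope ring_scope.
Variables (R : realFieldType) (G : sgraph) (k q : nat) (lam : R) (x : G -> R).
Hypothesis G_deg : degenerate G k.
Hypothesis G_common : forall L : {set G}, #|L| = q.+1 -> (#|common L| < k)%N.
Hypothesis xE : eigenfun lam x.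
Hypotheses (x_ge0 : forall u, 0 <= x u) (x_le1 : forall u, x u <= 1).
Hypothesis lam_gt0 : 0 < lam.

Let n := #|G|.
Let N : R := n%:R.
Let kap : R := k%:R.

Lemma eigen_nbr u : \sum_(v in nbr u) x v = lam * x u.
Proof. by rewrite -xE; apply: eq_bigl => v; rewrite inE. Qed.

Lemma sum_le_card (S : {set G}) : \sum_(u in S) x u <= #|S|%:R.
Proof.
by rewrite -sum1_card natr_sum; apply: ler_sum => u _; apply: x_le1.
Qed.

Lemma degree_sum : \sum_(u : G) (#|nbr u|%:R : R) <= 2 * kap * N.
Proof.
have := degenerate_degree_sum [set: G] G_deg.
rewrite -(ler_nat R) !natrM natr_sum cardsT; apply: le_trans.
rewrite le_eqVlt; apply/orP; left; apply/eqP.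
by apply: eq_big => [u|u _]; rewrite ?inE // setIT.
Qed.

Definition heavy (eps : R) : {set G} := [set w | eps <= x w].
Definition heavy_sum (eps : R) (t : G) : R := \sum_(w in nbr t :&: heavy eps) x w.

(** The left side is the weight of walks of length 2 from [v]. Those with a light end cost at most
    [eps] times the degree sum, which is linear in [N]. *)
Lemma walk2_bound (eps : R) v : 0 <= eps ->
  lam ^+ 2 * x v <= \sum_(t in nbr v) heavy_sum eps t + 2 * kap * eps * N.
Proof.
move=> eps_ge0.
have -> : lam ^+ 2 * x v = \sum_(t in nbr v) \sum_(w in nbr t) x w.
  rewrite expr2 -mulrA -eigen_nbr mulr_sumr.
  by apply: eq_bigr => t _; rewrite eigen_nbr.
have light t : \sum_(w in nbr t) x w <= heavy_sum eps t + eps * #|nbr t|%:R.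
  rewrite (bigID (mem (heavy eps))) /=; apply: lerD.
    rewrite /heavy_sum le_eqVlt; apply/orP; left; apply/eqP/eq_bigl => w.
    by rewrite [RHS]inE.
  apply: le_trans (_ : \sum_(w in nbr t | w \notin heavy eps) eps <= _).
    by apply: ler_sum => w /andP[_]; rewrite inE -ltNge => /ltW.
  rewrite sumr_const -[eps *+ _]mulr_natr ler_wpM2l // ler_nat.
  by apply/subset_leq_card/subsetP => w /andP[].
apply: le_trans (_ : \sum_(t in nbr v) (heavy_sum eps t + eps * #|nbr t|%:R) <= _).
  by apply: ler_sum => t _.
rewrite big_split lerD2l -mulr_sumr.
have -> : 2 * kap * eps * N = eps * (2 * kap * N) by ring.
apply: ler_wpM2l => //; apply: le_trans degree_sum.
rewrite [X in _ <= X](bigID (mem (nbr v))) /= lerDl; apply: sumr_ge0 => *.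
exact: ler0n.
Qed.

(** As weights are at most 1, a vertex of weight [eps] has degree at least [eps * lam]. This is the
    crude bound, of order [N / lam]. *)
Lemma heavy_card (eps : R) : 0 <= eps -> eps * lam * #|heavy eps|%:R <= 2 * kap * N.
Proof.
move=> eps_ge0; apply: le_trans degree_sum.
rewrite [X in _ <= X](bigID (mem (heavy eps))) /=.
rewrite -[X in X <= _]addr0; apply: lerD; last first.
  by apply: sumr_ge0 => *; apply: ler0n.
rewrite mulr_natr -sumr_const; apply: ler_sum => u; rewrite inE => xu.
apply: le_trans (sum_le_card (nbr u)); rewrite eigen_nbr mulrC.
by rewrite ler_wpM2l // ltW.
Qed.

(** The edges counted lie inside the union [U] of the two sets, where degeneracy makes the degree
    sum linear in [#|U|]. *)
Lemma heavy_sum_le (eps : R) v : \sum_(t in nbr v) heavy_sum eps t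
  <= 2 * kap * (#|nbr v|%:R + #|heavy eps|%:R).
Proof.
set U := nbr v :|: heavy eps.
have leU := degenerate_degree_sum U G_deg.
have leU' : #|U|%:R <= #|nbr v|%:R + #|heavy eps|%:R :> R.
  by rewrite -natrD ler_nat leq_card_setU.
apply: le_trans (_ : (\sum_(u in U) #|nbr u :&: U|)%:R <= _); last first.
  rewrite -(ler_nat R) in leU; apply: le_trans leU _.
  rewrite !natrM; apply: ler_wpM2l => //.
  by rewrite mulr_ge0 ?ler0n.
rewrite natr_sum [X in _ <= X](bigID (mem (nbr v))) /=.
rewrite -[X in X <= _]addr0; apply: lerD; last first.
  by apply: sumr_ge0 => *; apply: ler0n.
have -> : \sum_(i in U | i \in nbr v) #|nbr i :&: U|%:R =
   \sum_(i in nbr v) #|nbr i :&: U|%:R :> R.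
  by apply: eq_bigl => u; rewrite !inE; case: adj; rewrite ?andbF.
apply: ler_sum => t _; apply: le_trans (sum_le_card _) _.
by rewrite ler_nat; apply/subset_leq_card/setIS/subsetUr.
Qed.

Hypotheses (q_gt0 : (0 < q)%N) (le_qk : (q <= k)%N).
Hypothesis lam_large : q%:R * (N - q%:R) <= lam ^+ 2.

(** [eta] is the threshold for heavy vertices, [K] will bound their number, and [e0 * N] is the
    total error of a walk count. Light ends use up half of it, [2 * kap * eta * N]; by [N_large] the
    other half absorbs [q ^ 2] and the at most [2 ^ K * k] crowded neighbours, worth at most [K]
    each. *)
Variables (e0 eta : R) (K : nat).
Hypotheses (e0_gt0 : 0 < e0) (e0_small : 1000 * kap ^+ 2 * e0 <= 1).
Hypothesis eta_def : 4 * kap * eta = e0.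
Hypothesis K_large : 16 * kap ^+ 2 <= eta * K%:R.
Hypothesis lam_eta : 128 * kap ^+ 3 <= eta ^+ 2 * lam.
Hypothesis N_large : q%:R ^+ 2 + (K * 2 ^ K * k)%:R <= e0 * N / 2.

Let kap_ge1 : 1 <= kap.
Proof. by rewrite ler1n; lia. Qed.

Let q_ge1 : 1 <= q%:R :> R.
Proof. by rewrite ler1n. Qed.

Let le_qkap : q%:R <= kap.
Proof. by rewrite ler_nat. Qed.

Let eta_gt0 : 0 < eta.
Proof.
have kap4 : 0 < 4 * kap by have := kap_ge1; lra.
by rewrite -(pmulr_rgt0 _ kap4) eta_def.
Qed.

Let e0_le : e0 <= 1/1000.
Proof.
have : 1 <= kap ^+ 2 by rewrite exprn_ege1.
move: e0_small e0_gt0; nra.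
Qed.

Let N_ge0 : 0 <= N. Proof. exact: ler0n. Qed.

Let q2_le : q%:R ^+ 2 <= e0 * N / 2.
Proof. by apply: le_trans N_large; rewrite lerDl ler0n. Qed.

Let lam2_ge : 3 / 4 * q%:R * N <= lam ^+ 2.
Proof.
apply: le_trans lam_large; move: q2_le q_ge1 e0_le N_ge0; nra.
Qed.

(** Walks are split at the lower threshold [eps], chosen so that light ends cost [eta * N / 4].
    [lam_eta] keeps the crude number of heavy ends within another [eta * N / 4], out of a total of
    at least [3 / 4 * eta * N]. *)
Lemma heavy_degree v : v \in heavy eta -> eta * N <= 8 * kap * #|nbr v|%:R.
Proof.
rewrite inE => xv; set d : R := #|nbr v|%:R.
pose eps := eta / (8 * kap).
have kap_gt0 : 0 < kap := lt_le_trans ltr01 kap_ge1.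
have eps_gt0 : 0 < eps by rewrite divr_gt0 ?mulr_gt0.
have epsE : 8 * kap * eps = eta by rewrite /eps; field; lra.
have := walk2_bound v (ltW eps_gt0).
have := heavy_sum_le eps v; have := heavy_card (ltW eps_gt0); rewrite -/d.
set L : R := #|heavy eps|%:R; set W := \sum_(t in _) _ => hL hW hx.
have L_ge0 : 0 <= L by apply: ler0n.
have hL2 : 2 * kap * L <= eta * N / 4.
  have h1 : eta * lam * L <= 16 * kap ^+ 2 * N.
    have : 8 * kap * (eps * lam * L) <= 8 * kap * (2 * kap * N).
      by rewrite ler_wpM2l //; lra.
    have -> : eta * lam * L = 8 * kap * (eps * lam * L) by rewrite -epsE; ring.
    lra.
  have h2 : 128 * kap ^+ 3 * L <= eta ^+ 2 * lam * L by rewrite ler_wpM2r.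
  have h3 : eta * (eta * lam * L) <= eta * (16 * kap ^+ 2 * N).
    by rewrite ler_wpM2l // ltW.
  have h4 : kap ^+ 2 * (128 * kap * L) <= kap ^+ 2 * (16 * eta * N) by lra.
  rewrite ler_pM2l ?exprn_gt0 // in h4; lra.
have hlow : 3 / 4 * N * eta <= lam ^+ 2 * x v.
  have h1 : 3 / 4 * N <= lam ^+ 2.
    by apply: le_trans lam2_ge; move: q_ge1 N_ge0; nra.
  apply: le_trans (_ : lam ^+ 2 * eta <= _); first by rewrite ler_wpM2r // ltW.
  by rewrite ler_wpM2l // sqr_ge0.
have h5 : 2 * kap * eps * N = eta * N / 4.
  by rewrite -epsE; field.
rewrite h5 in hx.
have : W <= 2 * kap * d + 2 * kap * L by rewrite -mulrDr.
lra.
Qed.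

Lemma N_gt0 : 0 < N.
Proof.
have : 0 < e0 * N / 2.
  by apply: lt_le_trans q2_le; rewrite exprn_gt0 // ltr0n.
by rewrite -mulrA pmulr_rgt0 // pmulr_lgt0 // invr_gt0 ltr0n.
Qed.

(** Linear degrees against a linear degree sum: the bound no longer grows with [N]. *)
Lemma heavy_card_le : (#|heavy eta| <= K)%N.
Proof.
rewrite -(ler_nat R); set h : R := _%:R.
have h1 : eta * N * h <= 8 * kap * (2 * kap * N).
  apply: le_trans (_ : 8 * kap * \sum_(u in heavy eta) #|nbr u|%:R <= _).
    rewrite mulr_natr -sumr_const mulr_sumr.
    by apply: ler_sum => u; apply: heavy_degree.
  apply: ler_wpM2l; first by have := kap_ge1; lra.
  apply: le_trans degree_sum.
  rewrite [X in _ <= X](bigID (mem (heavy eta))) /= lerDl; apply: sumr_ge0 => *.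
  exact: ler0n.
have h2 : N * (eta * h) <= N * (eta * K%:R).
  apply: le_trans (_ : N * (16 * kap ^+ 2) <= _); last by rewrite ler_wpM2l.
  lra.
by rewrite ler_pM2l ?N_gt0 // ler_pM2l in h2.
Qed.

Definition crowded : {set G} := [set t | q < #|nbr t :&: heavy eta|]%N.

(** A crowded vertex is a common neighbour of some [q.+1] heavy vertices. At most [2 ^ K] such sets
    exist, each with fewer than [k] common neighbours. *)
Lemma crowded_card : (#|crowded| <= 2 ^ K * k)%N.
Proof.
apply: leq_trans
  (_ : #|\bigcup_(S in powerset (heavy eta) | #|S| == q.+1) common S| <= _)%N.
  apply/subset_leq_card/subsetP => t; rewrite inE => lt.
  pose S := [set z in take q.+1 (enum (nbr t :&: heavy eta))].
  have sS z : z \in S -> z \in nbr t :&: heavy eta.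
    by rewrite inE => /mem_take; rewrite mem_enum.
  apply/bigcupP; exists S; last first.
    by rewrite inE; apply/subsetP => z /sS /setIP[].
  rewrite powersetE; apply/andP; split.
    by apply/subsetP => z /sS /setIP[].
  rewrite cardsE; apply/eqP; rewrite (card_uniqP _) ?take_uniq ?enum_uniq //.
  by rewrite size_takel // -cardE.
apply: leq_trans (_ : \sum_(S in powerset (heavy eta) | #|S| == q.+1) #|common S| <= _)%N.
  elim/big_rec2: _ => [|S m U _ le]; first by rewrite cards0.
  by apply: leq_trans (leq_card_setU _ _) _; rewrite leq_add2l.
apply: leq_trans (_ : \sum_(S in powerset (heavy eta)) k <= _)%N.
  rewrite big_mkcondr; apply: leq_sum => S _; case: eqP => // /G_common.
  exact: ltnW.
rewrite sum_nat_const card_powerset leq_mul2r leq_exp2l // heavy_card_le.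
exact: orbT.
Qed.

Let C : R := (K * 2 ^ K * k)%:R.

Lemma heavy_sum_bounds t :
  heavy_sum eta t <= K%:R /\ (t \notin crowded -> heavy_sum eta t <= q%:R).
Proof.
split=> [|]; last rewrite inE -leqNgt => le.
  apply: le_trans (sum_le_card _) _; rewrite ler_nat.
  exact: leq_trans (subset_leq_card (subsetIr _ _)) heavy_card_le.
by apply: le_trans (sum_le_card _) _; rewrite ler_nat.
Qed.

Lemma heavy_sum_total v (b : R) : 0 <= b ->
  (forall t, t \in nbr v -> t \notin crowded -> heavy_sum eta t <= b) ->
  \sum_(t in nbr v) heavy_sum eta t <= b * #|nbr v|%:R + C.
Proof.
move=> b_ge0 hb; rewrite (bigID (mem crowded)) /= addrC; apply: lerD.
  apply: le_trans (_ : \sum_(t in nbr v | t \notin crowded) b <= _).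
    by apply: ler_sum => t /andP[]; apply: hb.
  rewrite sumr_const -[b *+ _]mulr_natr ler_wpM2l // ler_nat.
  by apply/subset_leq_card/subsetP => t /andP[].
apply: le_trans (_ : \sum_(t in nbr v | t \in crowded) K%:R <= _).
  by apply: ler_sum => t _; case: (heavy_sum_bounds t).
rewrite sumr_const -[K%:R *+ _]mulr_natr -natrM ler_nat -mulnA leq_mul2l.
apply/orP; right.
apply: leq_trans crowded_card.
by apply/subset_leq_card/subsetP => t /andP[].
Qed.

Lemma walk2_light v (W : R) : \sum_(t in nbr v) heavy_sum eta t <= W + C ->
  q%:R * N * x v <= W + e0 * N.
Proof.
move=> hW; have := walk2_bound v (ltW eta_gt0).
have h1 : q%:R * (N - q%:R) * x v <= lam ^+ 2 * x v by rewrite ler_wpM2r.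
have h2 : q%:R ^+ 2 * x v <= q%:R ^+ 2.
  by rewrite -[X in _ <= X]mulr1 ler_wpM2l // sqr_ge0.
have -> : 2 * kap * eta * N = e0 * N / 2 by rewrite -eta_def; field.
have := N_large; rewrite -/C; lra.
Qed.

(** If every uncrowded [t] had [heavy_sum eta t <= q - 2 * e0], the walk count at [u0] would fall
    short of [q * N]. The heavy neighbours of an exceptional [t] number at most [q] and weigh at
    most 1 each, so there are exactly [q], all of weight near 1; they form [L]. *)
Lemma localization u0 : x u0 = 1 -> exists L : {set G},
  [/\ #|L| = q, forall w, w \in L -> 1 - 2 * e0 <= x w
    & #|~: common L|%:R <= 3 * q%:R * e0 * N].
Proof.
move=> xu0.
have qe_ge0 : 0 <= q%:R - 2 * e0 by move: q_ge1 e0_le; lra.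
have [t tC tW] : exists2 t, t \notin crowded & q%:R - 2 * e0 < heavy_sum eta t.
  case: (pickP [pred t | (t \notin crowded) && (q%:R - 2 * e0 < heavy_sum eta t)]).
    by move=> t /andP[]; exists t.
  move=> none; suff : q%:R * N * x u0 <= (q%:R - 2 * e0) * N + e0 * N.
    by rewrite xu0; have := N_gt0; move: e0_gt0; nra.
  apply: walk2_light; apply: le_trans (heavy_sum_total (v := u0) qe_ge0 _) _.
    by move=> t _ tC; rewrite leNgt; have := none t; rewrite /= tC /= => ->.
  by rewrite lerD2r ler_wpM2l // ler_nat max_card.
pose L := nbr t :&: heavy eta.
have leLq : (#|L| <= q)%N by move: tC; rewrite inE -leqNgt.
have Lq : #|L| = q.
  apply/eqP; rewrite eqn_leq leLq /= -ltnS -(ltr_nat R) -addn1 natrD.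
  have := le_trans (ltW tW) (sum_le_card _); rewrite -/L; move: e0_le; lra.
have xL w : w \in L -> 1 - 2 * e0 <= x w.
  move=> wL; have := tW; rewrite /heavy_sum -/L (big_setD1 w) //=.
  have := sum_le_card (L :\ w); have := cardsD1 w L; rewrite wL Lq add1n => qE.
  rewrite qE -natr1; lra.
exists L; split=> //.
have degL w : w \in L -> #|~: nbr w|%:R <= 3 * e0 * N.
  (* The walk count read in the other direction: each uncrowded neighbour of [w] contributes at most
     [q], so a weight near 1 forces a degree near [N]. *)
  move=> wL; have h : q%:R * N * x w <= q%:R * #|nbr w|%:R + e0 * N.
    apply: walk2_light; apply: heavy_sum_total; first by have := q_ge1; lra.
    by move=> s _; case: (heavy_sum_bounds s).
  have cE : #|nbr w|%:R + #|~: nbr w|%:R = N by rewrite -natrD cardsC.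
  set d : R := #|nbr w|%:R in h cE; set d' : R := _%:R in cE *.
  have h1 : q%:R * N * (1 - 2 * e0) <= q%:R * N * x w.
    by rewrite ler_wpM2l ?xL // mulr_ge0 // ler0n.
  have h2 : e0 * N <= q%:R * (e0 * N).
    by rewrite ler_peMl // mulr_ge0 // ltW.
  have : q%:R * d' <= q%:R * (3 * e0 * N).
    have -> : d' = N - d by lra.
    lra.
  by rewrite ler_pM2l // ltr0n.
apply: le_trans (_ : \sum_(w in L) #|~: nbr w|%:R <= _).
  rewrite -natr_sum ler_nat.
  apply: leq_trans (_ : #|\bigcup_(w in L) ~: nbr w| <= _)%N; last first.
    elim/big_rec2: _ => [|w m U _ le]; first by rewrite cards0.
    by apply: leq_trans (leq_card_setU _ _) _; rewrite leq_add2l.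
  apply/subset_leq_card/subsetP => r; rewrite !inE => /subsetPn[w wL].
  by rewrite in_nbr adj_sym => rw; apply/bigcupP; exists w => //; rewrite !inE.
apply: le_trans (_ : \sum_(w in L) 3 * e0 * N <= _); first exact: ler_sum.
by rewrite sumr_const Lq -[_ *+ q]mulr_natl; lra.
Qed.

(** Vertices of [E] see only [L] and [E], because those of [common L] see only [L]. Two steps of the
    eigenvector equation then bound [lam ^ 2 * x e] by [q * lam] plus a multiple of [#|E|], which is
    a small fraction of [N]. *)
Lemma residual_small (L : {set G}) : #|L| = q ->
  #|~: common L|%:R <= 3 * q%:R * e0 * N ->
  (forall r, r \in common L -> nbr r \subset L) ->
  forall e, e \in ~: (L :|: common L) -> 8 * kap * x e <= 1.
Proof.
move=> Lq RN Rnbr; set E := ~: (L :|: common L).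
have EN : #|E|%:R <= 3 * q%:R * e0 * N.
  apply: le_trans RN; rewrite ler_nat; apply/subset_leq_card.
  by rewrite setCS subsetUr.
have nbrE e : e \in E -> nbr e \subset L :|: E.
  rewrite !inE negb_or => /andP[eL _]; apply/subsetP => z; rewrite !inE => ez.
  case: (boolP (z \in L)) => //= _; apply/negP => zR.
  have := Rnbr z; rewrite inE => /(_ zR)/subsetP/(_ e).
  by rewrite in_nbr adj_sym ez (negbTE eL) => /(_ isT).
have lamE e : e \in E -> lam * x e <= q%:R + \sum_(z in nbr e :&: E) x z.
  move=> eE; rewrite -eigen_nbr (bigID (mem E)) /= addrC; apply: lerD; last first.
    by rewrite le_eqVlt; apply/orP; left; apply/eqP/eq_bigl => z; rewrite [RHS]inE.
  apply: le_trans (_ : \sum_(z in L) x z <= _).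
    rewrite big_mkcond [X in _ <= X]big_mkcond; apply: ler_sum => z _.
    case: ifP => [/andP[ez zE]|_]; last by case: ifP.
    by have /subsetP/(_ z ez) := nbrE e eE; rewrite inE (negbTE zE) orbF => ->.
  by apply: le_trans (sum_le_card _) _; rewrite Lq.
move=> e eE; set s : R := #|E|%:R in EN.
have sumE : \sum_(z in E) lam * x z <= q%:R * s + 2 * kap * s.
  apply: le_trans (_ : \sum_(z in E) (q%:R + #|nbr z :&: E|%:R) <= _).
    apply: ler_sum => z zE; apply: le_trans (lamE z zE) _.
    by rewrite lerD2l sum_le_card.
  rewrite big_split /= sumr_const -[q%:R *+ _]mulr_natr lerD2l.
  have := degenerate_degree_sum E G_deg.
  by rewrite -(ler_nat R) !natrM natr_sum.
have l2 : lam ^+ 2 * x e <= q%:R * lam + (q%:R * s + 2 * kap * s).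
  rewrite expr2 -mulrA; apply: le_trans (ler_wpM2l (ltW lam_gt0) (lamE e eE)) _.
  rewrite mulrDr [lam * q%:R]mulrC lerD2l; apply: le_trans sumE.
  rewrite mulr_sumr big_mkcond [X in _ <= X]big_mkcond; apply: ler_sum => z _.
  rewrite inE; case: ifP => [/andP[_ ->] //|_]; case: ifP => // _.
  by rewrite mulr_ge0 // ltW.
have kap_gt0 : 0 < kap := lt_le_trans ltr01 kap_ge1.
have s_ge0 : 0 <= s by apply: ler0n.
have lam_big : 128 * kap ^+ 3 <= lam.
  apply: le_trans lam_eta _; rewrite ger_pMl //.
  have eta_le1 : eta <= 1.
    move: eta_def e0_le kap_ge1 eta_gt0 => h1 h2 h3 h4.
    have : eta <= kap * eta by rewrite ler_peMl // ltW.
    lra.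
  by rewrite expr_le1 // ltW.
(* Each of the two summands in [l2] is allotted half of [lam ^ 2 / (8 * kap)]. *)
have h1 : 16 * kap * (q%:R * lam) <= lam ^+ 2.
  rewrite expr2 mulrA ler_wpM2r ?(ltW lam_gt0) //.
  apply: le_trans lam_big.
  have k3 : kap ^+ 2 <= kap ^+ 3 by rewrite ler_weXn2l.
  have : kap * q%:R <= kap ^+ 2 by rewrite expr2 ler_wpM2l // ltW.
  have : 0 <= kap ^+ 2 by apply: sqr_ge0.
  lra.
have h2 : 16 * kap * (q%:R * s + 2 * kap * s) <= lam ^+ 2.
  have a1 : q%:R * s + 2 * kap * s <= 3 * kap * s.
    have : q%:R * s <= kap * s by rewrite ler_wpM2r.
    lra.
  have a2 : 16 * kap * (q%:R * s + 2 * kap * s) <= 16 * kap * (3 * kap * s).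
    by rewrite ler_wpM2l //; lra.
  have a3 : kap ^+ 2 * s <= kap ^+ 2 * (3 * q%:R * e0 * N).
    by rewrite ler_wpM2l // sqr_ge0.
  have qN_ge0 : 0 <= q%:R * N by rewrite mulr_ge0 // ler0n.
  have a4 : (q%:R * N) * (1000 * kap ^+ 2 * e0) <= (q%:R * N) * 1.
    by rewrite ler_wpM2l.
  have := lam2_ge; lra.
have l2_gt0 : 0 < lam ^+ 2 by rewrite exprn_gt0.
rewrite -(ler_pM2l l2_gt0) mulr1.
have : 8 * kap * (lam ^+ 2 * x e) <= 8 * kap * (q%:R * lam + (q%:R * s + 2 * kap * s)).
  by rewrite ler_wpM2l //; lra.
lra.
Qed.

End Localization.

(** * Edge counts and a lower bound on the spectral radius *)

Lemma handshake (G : sgraph) : \sum_(u : G) deg u = 2 * #|edges G|.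
Proof.
have -> : \sum_(u : G) deg u = \sum_(p : G * G | adj p.1 p.2) 1.
  rewrite -(pair_big_dep xpredT (fun u v => adj u v) (fun _ _ => 1)) /=.
  by apply: eq_bigr => u _; rewrite sum1dep_card.
rewrite (partition_big (fun p : G * G => [set p.1; p.2]) (mem (edges G))) /=; last first.
  move=> [u v] /= uv; rewrite inE; apply/existsP; exists u; apply/existsP; exists v.
  by rewrite uv /=.
rewrite mulnC -sum_nat_const; apply: eq_bigr => e; rewrite inE.
move=> /existsP[u /existsP[v /andP[uv /eqP ->]]].
have nuv : u != v by apply: contraTneq uv => ->; rewrite adj_irrefl.
rewrite sum1dep_card; transitivity #|[set (u, v); (v, u)]|; last first.
  by rewrite cards2 xpair_eqE negb_and nuv.
apply: eq_card => -[a b]; rewrite !inE /= !xpair_eqE.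
apply/andP/orP => [[ab /eqP e2]|[]/andP[/eqP-> /eqP->]]; last 2 first.
- by rewrite uv eqxx.
- by rewrite adj_sym uv setUC eqxx.
have nab : a != b by apply: contraTneq ab => ->; rewrite adj_irrefl.
have /set2P aE : a \in [set u; v] by rewrite -e2 !inE eqxx.
have /set2P bE : b \in [set u; v] by rewrite -e2 !inE eqxx orbT.
by move: nab; case: aE => ->; case: bE => ->; rewrite ?eqxx //; [left | right].
Qed.

Lemma iso_deg_sum (G H : sgraph) : iso G H ->
  \sum_(u : G) deg u = \sum_(u : H) deg u.
Proof.
case=> f f_bij f_adj; rewrite [RHS](reindex f) /=; last exact: onW_bij.
apply: eq_bigr => u _; rewrite /deg -(card_imset _ (bij_inj f_bij)).
apply: eq_card => v; have [g fK gK] := f_bij.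
apply/imsetP/idP => [[w + ->]|]; first by rewrite !inE f_adj.
rewrite inE -{1}(gK v) f_adj => uv; exists (g v); rewrite ?gK //.
by rewrite inE.
Qed.

Lemma deg_sum_join_edgeless (Q : sgraph) m :
  \sum_(u : join Q (edgeless m)) deg u = \sum_(u : Q) deg u + 2 * (#|Q| * m).
Proof.
have cE (P : pred (join Q (edgeless m))) :
    #|[set z | P z]| = #|[set z | P (inl z)]| + #|[set z | P (inr z)]|.
  rewrite -!sum1dep_card big_mkcond big_sumType /=.
  by rewrite [in RHS]big_mkcond [X in _ = _ + X]big_mkcond.
rewrite big_sumType /=.
have -> : \sum_(i : Q) deg (inl i : join Q (edgeless m)) = \sum_(i : Q) (deg i + m).
  apply: eq_bigr => i _; rewrite /deg cE /=; congr (_ + _).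
  by rewrite -[RHS](card_ord m) -cardsT; apply: eq_card => z; rewrite !inE.
have -> : \sum_(i : 'I_m) deg (inr i : join Q (edgeless m)) = \sum_(i : 'I_m) #|Q|.
  apply: eq_bigr => i _; rewrite /deg cE /=.
  rewrite -[RHS]addn0; congr (_ + _).
    by rewrite -cardsT; apply: eq_card => z; rewrite !inE.
  by apply/eqP; rewrite cards_eq0; apply/eqP/setP => z; rewrite !inE.
by rewrite big_split /= !sum_nat_const card_ord -addnA mul2n -addnn [(m * _)%N]mulnC.
Qed.

Lemma join_isol (Q Q' H : sgraph) : iso Q Q' -> iso (join Q H) (join Q' H).
Proof.
case=> f [g fK gK] f_adj.
exists (fun u => match u with inl a => inl (f a) | inr b => inr b end).
  exists (fun u => match u with inl a => inl (g a) | inr b => inr b end).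
    by case=> // a; rewrite fK.
  by case=> // a; rewrite gK.
by case=> a [] b //=; apply: f_adj.
Qed.

Lemma edgeless_iso (G : sgraph) q : #|G| = q -> #|edges G| = 0 -> iso G (edgeless q).
Proof.
move=> Gq; subst q => e0; exists (@enum_rank G); first exact: enum_rank_bij.
move=> x y /=; apply/esym/negbTE/negP => xy.
have /eqP := handshake G; rewrite e0 muln0 sum_nat_eq0 => /forallP/(_ x) /=.
by rewrite cards_eq0 => /eqP/setP/(_ y); rewrite !inE xy.
Qed.

Lemma edgeless_edges q : #|edges (edgeless q)| = 0.
Proof.
apply/eqP; rewrite cards_eq0; apply/eqP/setP => e; rewrite !inE.
by apply/existsP => -[x /existsP[y]].
Qed.

Lemma iso_edges (G H : sgraph) : iso G H -> #|edges G| = #|edges H|.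
Proof. by move=> /iso_deg_sum; rewrite !handshake; lia. Qed.

Lemma complete_iso (G : sgraph) q : #|G| = q ->
  #|edges (complete q)| <= #|edges G| -> iso G (complete q).
Proof.
move=> Gq; subst q => le; exists (@enum_rank G); first exact: enum_rank_bij.
have degK (i : complete #|G|) : deg i = #|G|.-1.
  rewrite /deg -[X in X.-1](card_ord #|G|) -(cardsC1 i); apply: eq_card => j.
  by rewrite !inE /= /complete_adj eq_sym.
have deg_le (x : G) : deg x <= #|G|.-1 by have := deg_lt x; lia.
have sum_ge : \sum_(x : G) #|G|.-1 <= \sum_(x : G) deg x.
  rewrite handshake.
  apply: leq_trans (_ : 2 * #|edges (complete #|G|)| <= _); last by lia.
  rewrite -handshake (eq_bigr _ (fun i _ => degK i)) !sum_nat_const.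
  by rewrite card_ord.
have degE (x : G) : deg x = #|G|.-1.
  apply/eqP; rewrite eqn_leq deg_le leqNgt; apply/negP => lt.
  move: sum_ge; rewrite (bigD1 x) //= [X in _ <= X](bigD1 x) //= leqNgt => /negP; apply.
  by rewrite -addSn leq_add // leq_sum.
move=> x y /=; rewrite /complete_adj (inj_eq enum_rank_inj).
have [->|nxy] := eqVneq x y; first by rewrite adj_irrefl.
have : [set z | adj x z] = [set~ x].
  apply/eqP; rewrite eqEcard cardsC1 -(degE x) leqnn andbT.
  by apply/subsetP => z; rewrite !inE; apply: contraTneq => ->; rewrite adj_irrefl.
by move=> /setP/(_ y); rewrite !inE eq_sym nxy.
Qed.

Section RhoLower.
Local Open Scope ring_scope.

(** Weights sqrt [m] on the [q] vertices and sqrt [q] on the [m] vertices form an eigenvector with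
    eigenvalue sqrt [(q * m)]. *)
Lemma rho_edgeless_join_ge q m : (0 < m)%N -> (0 < q)%N ->
  q%:R * m%:R <= rhoR (join (edgeless q) (edgeless m)) ^+ 2.
Proof.
move=> m_gt0 q_gt0; set G := join _ _.
pose a : algR := Num.sqrt q%:R; pose b : algR := Num.sqrt m%:R.
have aa : a * a = q%:R by rewrite -expr2 sqr_sqrtr ?ler0n.
have bb : b * b = m%:R by rewrite -expr2 sqr_sqrtr ?ler0n.
have a_ge0 : 0 <= a by apply: sqrtr_ge0.
have b_gt0 : 0 < b by rewrite sqrtr_gt0 ltr0n.
pose x (u : G) := match u with inl _ => b | inr _ => a end.
have xE : eigenfun (a * b) x.
  move=> [i|i]; rewrite big_mkcond big_sumType /=.
    rewrite big1 ?add0r // sumr_const card_ord -mulr_natl -bb.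
    ring.
  rewrite [X in _ + X]big1 ?addr0 // sumr_const card_ord -mulr_natl -aa.
  ring.
have le : a * b <= rhoR G.
  apply: (eigenfun_le_rho xE); exists (inl (Ordinal q_gt0)).
  by rewrite /= gt_eqF.
have -> : q%:R * m%:R = (a * b) ^+ 2 by rewrite -aa -bb; ring.
by rewrite lerXn2r // nnegrE ?rhoR_ge0 // mulr_ge0 // ltW.
Qed.

End RhoLower.

(** * Trees with a leaf in the smaller part *)

(** An edge [r w] leaving [L] hosts the leaf: its neighbour [b] goes to [r], [a] to [w], the rest of
    [A] into [L], everything else into [common L]. The image of [a] need not see [common L], as [b]
    is its only neighbour. The excess 2 in the size of [common L] pays for removing [r] and [w]. *)
Lemma leaf_common_nbr (F G : sgraph) (A B : {set F}) (a : F) (L : {set G}) :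
  partite_sets A B -> a \in A -> deg a = 1 -> ~ contains G F ->
  #|A| <= #|L|.+1 -> #|F|.+2 <= #|common L| ->
  forall r, r \in common L -> nbr r \subset L.
Proof.
move=> AB aA da Gfree leA leF r rR; apply/subsetP => w; rewrite in_nbr => rw.
apply: contraT => wL; case: Gfree.
have /eqP/cards1P[b ab] := da.
have aE y : adj a y -> y = b by move=> ay; apply/set1P; rewrite -ab inE.
have {}ab : adj a b by have := set11 b; rewrite -ab inE.
have [AB1 dAB /independentP iA /independentP iB] := AB.
have bA : b \notin A by apply/negP => bA; have := iA a b aA bA; rewrite ab.
have inB z : z \notin A -> z \in B.
  by have := in_setT z; rewrite -AB1 inE => /orP[->|].
have [|g0 [g0_inj g0L]] := @inj_on_exists F G (A :\ a) L _ r.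
  by have := cardsD1 a A; rewrite aA; lia.
pose g x := if x == b then r else if x == a then w else g0 x.
have rL : r \notin L by apply: contraTN rR => /notin_common.
have nrw : r != w by apply: contraTneq rw => ->; rewrite adj_irrefl.
have nab : a != b by apply: contraTneq ab => ->; rewrite adj_irrefl.
have SA x : x \in b |: A -> x != b -> x != a -> x \in A :\ a.
  by rewrite !inE => /orP[->|->] // _ ->.
apply: (@embed_extend F G (b |: A) g (common L :\ r :\ w)).
- apply: vertex_coverI => x y xy; rewrite !inE negb_or => /andP[_ xA].
  by rewrite (cover_out (partite_cover AB) xy xA) orbT.
- move=> x y xS yS; rewrite /g.
  have [->|xb] := eqVneq x b; have [->|yb] := eqVneq y b => //.
  + have [->|ya] := eqVneq y a => [/eqP|e]; first by rewrite (negbTE nrw).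
    by case/negP: rL; rewrite e g0L // SA.
  + have [->|xa] := eqVneq x a => [/esym/eqP|e]; first by rewrite (negbTE nrw).
    by case/negP: rL; rewrite -e g0L // SA.
  have [->|xa] := eqVneq x a; have [->|ya] := eqVneq y a => //.
  + by move=> e; case/negP: wL; rewrite e g0L // SA.
  + by move=> e; case/negP: wL; rewrite -e g0L // SA.
  + by apply: g0_inj; rewrite SA.
(* [A] is independent, so every edge inside [b |: A] has [b] as an end; [half] treats one
   orientation. *)
- have half x y : x \in b |: A -> y \in b |: A -> adj x y -> y = b -> adj (g x) (g y).
    move=> xS _ xy yb; subst y; rewrite {2}/g eqxx /g.
    have xb : x != b by apply: contraTneq xy => ->; rewrite adj_irrefl.
    rewrite (negbTE xb); have [_|xa] := eqVneq x a; first by rewrite adj_sym.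
    by apply: in_common rR _; rewrite g0L // SA.
  move=> x y xS yS xy.
  have [yb|yb] := eqVneq y b; first exact: half.
  have [xb|xb] := eqVneq x b.
    by rewrite adj_sym; apply: half => //; rewrite adj_sym.
  have inA z : z \in b |: A -> z != b -> z \in A by rewrite !inE => /orP[->|].
  by have := iA x y (inA _ xS xb) (inA _ yS yb); rewrite xy.
- have := cardsD1 r (common L); have := cardsD1 w (common L :\ r); lia.
- move=> s sS; rewrite /g; have [_|sb] := eqVneq s b; first by rewrite !inE eqxx andbF.
  have [_|sa] := eqVneq s a; first by rewrite !inE eqxx.
  rewrite !in_setD1 (negbTE (notin_common _)) ?andbF //.
  by rewrite g0L // SA.
- move=> s x sS xS sx z /setD1P[_ /setD1P[_ zR]]; rewrite /g.
  have [sb|sb] := eqVneq s b.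
    move: xS; rewrite !inE negb_or => /andP[xb xA].
    have := iB s x _ (inB x xA); rewrite sx => /(_ _)/negP; case=> //.
    by rewrite sb inB.
  have [sa|sa] := eqVneq s a.
    by move: xS; rewrite (aE x) -?sa // !inE eqxx.
  by apply: in_common zR _; rewrite g0L // SA.
Qed.

(** A copy of [F] in the cone has a cover inside [L], where the edges are those of [G]; the other
    vertices are moved into [common L]. *)
Lemma cone_adj_free (F G : sgraph) (L : {set G}) :
  ~ contains G F -> #|F| <= #|common L| ->
  ~ contains (cone L (@adj_sym G) (@adj_irrefl G)) F.
Proof.
move=> Gfree leF [f f_inj f_adj]; apply: Gfree.
have [cS _ f_adj'] := contains_cone f_inj f_adj.
apply: (@embed_common F G _ f L cS) => //.
- by move=> x y _ _; apply: f_inj.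
- by move=> x; rewrite inE.
Qed.

Lemma cone_iso (G : sgraph) (L : {set G}) n : #|G| = n ->
  (forall u v, u \notin L -> adj u v = (v \in L)) ->
  iso G (join (induced L) (edgeless (n - #|L|))).
Proof.
move=> Gn GL; apply: iso_sym.
have cE : n - #|L| = #|~: L| by rewrite -Gn -(cardsC L) addKn.
rewrite cE.
pose f (u : join (induced L) (edgeless #|~: L|)) : G :=
  match u with inl x => val x | inr i => enum_val i end.
have fL i : f (inr i) \notin L by have := enum_valP i; rewrite inE.
exists f; last first.
  move=> [x|i] [y|j] //=.
  - by rewrite adj_sym GL; [rewrite (valP x) | exact: (fL j)].
  - by rewrite GL; [rewrite (valP y) | exact: (fL i)].
  - by rewrite GL; [exact: negbTE (fL j) | exact: (fL i)].
have f_inj : injective f.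
  move=> [x|i] [y|j] /= e.
  - by congr inl; apply: val_inj.
  - by have := fL j; rewrite /= -e (valP x).
  - by have := fL i; rewrite /= e (valP y).
  - by congr inr; apply: enum_val_inj e.
apply: (inj_card_bij f_inj); rewrite /= card_sum card_sig card_ord.
by rewrite -(cardsC L).
Qed.

Lemma deg_sum_image (T : finType) (L : {set T}) (H : sgraph) (f : T -> H) :
  {in L &, injective f} -> #|H| = #|L| ->
  \sum_(y : H) deg y = \sum_(u in L) #|[set v in L | adj (f u) (f v)]|.
Proof.
move=> f_inj HL; have fT : f @: L = setT.
  by apply/eqP; rewrite eqEcard subsetT cardsT card_in_imset // HL /=.
transitivity (\sum_(y in f @: L) deg y).
  by apply: eq_bigl => y; rewrite fT inE.
rewrite big_imset //; apply: eq_bigr => u uL; rewrite /deg.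
rewrite -(card_in_imset (f := f) (D := mem [set v in L | adj (f u) (f v)])); last first.
  by move=> v w; rewrite !inE => /andP[vL _] /andP[wL _]; apply: f_inj.
apply: eq_card => y; rewrite !inE; apply/idP/imsetP => [uy|[v + ->]].
  have : y \in f @: L by rewrite fT inE.
  by case/imsetP=> v vL yE; exists v => //; rewrite inE vL -yE.
by rewrite inE => /andP[].
Qed.

(** * Comparing [G] with cones over [L] *)

Section Compare.
Local Open Scope ring_scope.

Lemma perron_normalized (G : sgraph) : (0 < #|G|)%N -> exists x : G -> algR,
  [/\ eigenfun (rhoR G) x, forall u, 0 <= x u, forall u, x u <= 1
    & exists u, x u = 1].
Proof.
move=> /perron_fun [y [yE y_ge0 [u0 yu0]]].
have [u _ u_max] := @arg_maxP _ _ _ u0 xpredT y isT.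
have yu : 0 < y u by apply: lt_le_trans yu0 (u_max _ _).
exists (fun v => y v / y u); split.
- by move=> v; rewrite -mulr_suml yE mulrA.
- by move=> v; rewrite divr_ge0 // ltW.
- by move=> v; rewrite ler_pdivrMr // mul1r; apply: u_max.
- by exists u; rewrite divff // gt_eqF.
Qed.

Variables (G : sgraph) (L : {set G}) (x : G -> algR).
Hypothesis x_ge0 : forall u, 0 <= x u.
Hypothesis xE : eigenfun (rhoR G) x.

Lemma sum_cone (e : rel G) (e_sym : symmetric e) (e_irr : irreflexive e) u :
  \sum_(v | adj (u : cone L e_sym e_irr) v) x v =
  if u \in L then \sum_(v in L | e u v) x v + \sum_(v in ~: L) x v
  else \sum_(v in L) x v.
Proof.
case: ifP => uL; last by apply: eq_bigl => v; rewrite /= /cone_adj uL.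
rewrite (bigID (mem L)) /=; congr (_ + _); apply: eq_bigl => v;
  rewrite /cone_adj uL ?inE; case: (v \in L); rewrite ?andbF ?andbT //.
Qed.

(** Passing to the cone, a vertex of [E] loses its edges inside [E] and gains at least one missing
    neighbour in [L], of weight at least [1 - 2 * e0]. Weights on [E] are at most [1 / (8 * k)], so
    degeneracy bounds the loss by [X / 4] and the net gain is at least [X / 2]. *)
Lemma residual_empty (k : nat) (e0 : algR) : degenerate G k -> (0 < k)%N ->
  rhoR (cone L (@adj_sym G) (@adj_irrefl G)) <= rhoR G ->
  e0 <= 1 / 1000 -> L != set0 ->
  (forall w, w \in L -> 1 - 2 * e0 <= x w) ->
  (forall r, r \in common L -> nbr r \subset L) ->
  (forall e, e \in ~: (L :|: common L) -> 8 * k%:R * x e <= 1) ->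
  L :|: common L = setT.
Proof.
move=> G_deg k_gt0 rho_le e0_le L0 xL Rnbr xsmall.
set E := ~: (L :|: common L); set G' := cone L _ _ in rho_le.
apply/eqP; rewrite -subTset; apply/subsetP => e1 _; apply: contraT => e1N.
have e1E : e1 \in E by rewrite inE.
set X := \sum_(u in E) x u.
have kap_ge1 : 1 <= k%:R :> algR by rewrite ler1n.
have nbr_sum u : \sum_(v | adj u v) x v = \sum_(v in nbr u) x v.
  by apply: eq_bigl => v; rewrite inE.
have RE u : u \in common L -> nbr u = L.
  move=> uR; apply/eqP; rewrite eqEsubset Rnbr //=.
  by move: uR; rewrite inE.
have EL u : u \in E -> u \notin L /\ u \notin common L.
  by rewrite !inE negb_or => /andP[].
have pointwise u : x u * \sum_(v | adj u v) x v +
    (if u \in E then x u * ((1 - 2 * e0) - \sum_(v in nbr u :&: E) x v) else 0)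
    <= x u * \sum_(v | adj (u : G') v) x v.
  rewrite sum_cone nbr_sum; have [uL|uL] := boolP (u \in L).
    rewrite (negbTE (_ : u \notin E)); last by rewrite !inE uL.
    rewrite addr0 ler_wpM2l // (bigID (mem L)) /=; apply: lerD.
      rewrite le_eqVlt; apply/orP; left; apply/eqP/eq_bigl => v.
      by rewrite in_nbr andbC.
    rewrite big_mkcond [X in _ <= X]big_mkcond; apply: ler_sum => v _.
    by rewrite !inE; case: (v \in L); rewrite ?andbF //=; case: ifP.
  have [uR|uR] := boolP (u \in common L).
    by rewrite RE // (negbTE (_ : u \notin E)) ?addr0 // in_setC in_setU uR orbT.
  have uE : u \in E by rewrite in_setC in_setU negb_or uL uR.
  rewrite uE -mulrDr ler_wpM2l //.
  have [v vL nuv] : exists2 v, v \in L & ~~ adj u v.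
    by move: uR; rewrite inE => /subsetPn[v vL]; rewrite in_nbr; exists v.
  have -> : \sum_(z in nbr u) x z =
     \sum_(z in nbr u :&: L) x z + \sum_(z in nbr u :&: E) x z.
    rewrite (bigID (mem L)) /=; congr (_ + _); apply: eq_bigl => z.
      by rewrite [RHS]inE.
    rewrite [RHS]inE; have [uz|//] := boolP (z \in nbr u).
    rewrite [in RHS]in_setC in_setU negb_or.
    have [//|zL /=] := boolP (z \in L); apply/esym/negP => zR.
    have := Rnbr z zR => /subsetP/(_ u); rewrite in_nbr adj_sym -in_nbr uz.
    by move/(_ isT); rewrite (negbTE uL).
  have h : \sum_(z in nbr u :&: L) x z + x v <= \sum_(z in L) x z.
    rewrite [X in _ <= X](big_setD1 v) //= [X in X <= _]addrC lerD2l.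
    rewrite big_mkcond [X in _ <= X]big_mkcond; apply: ler_sum => z _.
    rewrite !inE; have [->|_] := eqVneq z v; first by rewrite (negbTE nuv).
    by case: (z \in L); rewrite ?andbF ?andbT //=; case: ifP.
  by have := xL v vL; lra.
pose s2 := \sum_u x u ^+ 2.
have s2_ge0 : 0 <= s2 by apply: sumr_ge0 => u _; apply: sqr_ge0.
have formG : \sum_u x u * \sum_(v | adj u v) x v = rhoR G * s2.
  by rewrite mulr_sumr; apply: eq_bigr => u _; rewrite xE expr2; ring.
have X_ge0 : 0 <= X by apply: sumr_ge0.
have formG' : rhoR G * s2 + X / 2 <= \sum_(u : G') x u * \sum_(v | adj u v) x v.
  apply: le_trans (ler_sum _ (fun u _ => pointwise u)).
  rewrite big_split /= formG lerD2l -big_mkcond /=.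
  under eq_bigr do rewrite mulrBr.
  rewrite sumrB -mulr_suml -/X.
  have h : \sum_(u in E) x u * (\sum_(v in nbr u :&: E) x v)
      <= (2 * k)%:R * (1 / (8 * k%:R)) * X.
    apply: degenerate_form => // u uE; rewrite ler_pdivlMr; last by lra.
    by rewrite mulrC xsmall.
  have hE : (2 * k)%:R * (1 / (8 * k%:R)) = 1 / 4 :> algR.
    by rewrite natrM; field; lra.
  rewrite hE in h.
  have : e0 * X <= (1 / 1000) * X by rewrite ler_wpM2r.
  by lra.
(* The gain only yields [X = 0]. The contradiction comes from equality: [x] is also an eigenvector
   of the cone, where [e1] has weight 0 but neighbours of positive weight. *)
have xE' : eigenfun (rhoR G') (x : G' -> algR).
  apply: rayleigh_eq; apply: le_trans formG'.
  apply: le_trans (ler_wpM2r s2_ge0 rho_le) _; lra.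
have X_le0 : X <= 0.
  have := le_trans formG' (rayleigh (x : G' -> algR)).
  have := ler_wpM2r s2_ge0 rho_le; rewrite -/s2; lra.
have xe1 : x e1 = 0.
  apply/le_anti; rewrite x_ge0 andbT; apply: le_trans X_le0.
  by rewrite /X (big_setD1 e1) //= lerDl sumr_ge0.
have := xE' e1; rewrite sum_cone xe1 mulr0 (negbTE (EL e1 e1E).1).
case/set0Pn: L0 => w wL; rewrite (big_setD1 w) //=.
have : 0 <= \sum_(i in L :\ w) x i by apply: sumr_ge0.
by have := xL w wL; lra.
Qed.

(** Replacing [G[L]] by [Q'] changes the form by the difference of two weighted edge counts [D]. All
    weights on [L] lie between [1 - 2 * e0] and 1, and [e0] is so small against [#|L| ^ 2] that a
    surplus of a single edge would outweigh the error. *)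
Lemma edges_le_of_rho (Q' : sgraph) (h : G -> Q') (e0 : algR) :
  L :|: common L = setT -> (forall r, r \in common L -> nbr r \subset L) ->
  #|Q'| = #|L| -> {in L &, injective h} ->
  0 < e0 -> 8 * (#|L| ^ 2).+1%:R * e0 < 1 ->
  (forall w, w \in L -> 1 - 2 * e0 <= x w) -> (forall w, x w <= 1) ->
  rhoR (@cone G L (fun u v => adj (h u) (h v))
     (fun u v => adj_sym (h u) (h v)) (fun u => adj_irrefl (h u))) <= rhoR G ->
  (#|edges Q'| <= #|edges (induced L)|)%N.
Proof.
move=> LT Rnbr Q'L h_inj e0_gt0 e0_le xL x_le1.
set G' := cone _ _ _ => rho_le; rewrite leqNgt; apply/negP => lt.
pose D (e : rel G) := \sum_(u in L) \sum_(v in L | e u v) x u * x v.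
have nL u : u \notin L -> nbr u = L.
  move=> uL; have uR : u \in common L.
    by have := in_setT u; rewrite -LT in_setU (negbTE uL).
  by apply/eqP; rewrite eqEsubset Rnbr //=; move: uR; rewrite inE.
have sumG u : \sum_(v | adj u v) x v =
    if u \in L then \sum_(v in L | adj u v) x v + \sum_(v in ~: L) x v
    else \sum_(v in L) x v.
  case: ifP => uL; last first.
    by apply: eq_bigl => v; rewrite -(nL u) ?uL ?inE.
  rewrite (bigID (mem L)) /=; congr (_ + _); apply: eq_bigl => v.
    by rewrite andbC.
  rewrite inE; have [|vL] := boolP (v \in L); rewrite ?andbF ?andbT //.
  by rewrite adj_sym -in_nbr nL.
have formE : \sum_(u : G') x u * (\sum_(v | adj u v) x v) =
    \sum_u x u * (\sum_(v | adj u v) x v) +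
    (D (fun u v => adj (h u) (h v)) - D (@adj G)).
  rewrite /D -sumrB [X in _ = _ + X]big_mkcond -big_split.
  apply: eq_bigr => u _; rewrite sum_cone sumG; case: ifP => uL /=.
    by rewrite -!mulr_sumr; ring.
  by rewrite addr0.
have pairs (H : sgraph) (f : G -> H) : {in L &, injective f} -> #|H| = #|L| ->
    \sum_(u in L) \sum_(v in L | adj (f u) (f v)) 1 = (2 * #|edges H|)%:R :> algR.
  move=> f_inj HL; rewrite -handshake (deg_sum_image f_inj HL) natr_sum.
  apply: eq_bigr => u _; rewrite sumr_const.
  by congr (_%:R); apply: eq_card => v; rewrite inE.
have [w0 w0L] : exists w0, w0 \in L.
  apply/set0Pn; rewrite -card_gt0 -Q'L; have /card_gt0P [e] := leq_ltn_trans (leq0n _) lt.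
  by rewrite inE => /existsP[y _]; apply/card_gt0P; exists y.
have DQ' : (1 - 2 * e0) ^+ 2 * (2 * #|edges Q'|)%:R <= D (fun u v => adj (h u) (h v)).
  rewrite -(pairs _ h) // mulr_sumr; apply: ler_sum => u uL.
  rewrite mulr_sumr; apply: ler_sum => v /andP[vL _]; rewrite mulr1 expr2.
  have e0_small : 0 <= 1 - 2 * e0.
    have : e0 <= (#|L| ^ 2).+1%:R * e0 by rewrite ler_peMl ?ler1n // ltW.
    by lra.
  by apply: ler_pM => //; apply: xL.
have DQ : D (@adj G) <= (2 * #|edges (induced L)|)%:R.
  pose f (u : G) : induced L := insubd (exist _ w0 w0L) u.
  have fE u : u \in L -> val (f u) = u by move=> uL; rewrite /f val_insubd uL.
  rewrite -(pairs _ f); first 1 last.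
  - by move=> u v uL vL /(congr1 val); rewrite !fE.
  - by rewrite /= card_sig.
  apply: ler_sum => u uL; rewrite (eq_bigl (fun v => (v \in L) && adj (f u) (f v))).
    by apply: ler_sum => v _; rewrite mulr_ile1.
  move=> v; have [vL|//] := boolP (v \in L).
  by rewrite /= /induced_adj !fE.
have le0 : D (fun u v => adj (h u) (h v)) - D (@adj G) <= 0.
  have := rayleigh (x : G' -> algR); rewrite formE.
  have -> : \sum_u x u * \sum_(v | adj u v) x v = rhoR G * \sum_u x u ^+ 2.
    by rewrite mulr_sumr; apply: eq_bigr => u _; rewrite xE expr2; ring.
  have s2_ge0 : 0 <= \sum_u x u ^+ 2 by apply: sumr_ge0 => u _; apply: sqr_ge0.
  have := ler_wpM2r s2_ge0 rho_le; lra.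
have mQ : (2 * #|edges (induced L)| <= #|L| ^ 2)%N.
  rewrite -handshake; apply: leq_trans (_ : \sum_(u : induced L) #|L| <= _)%N.
    apply: leq_sum => u _; apply: leq_trans (max_card _) _.
    by rewrite /= card_sig.
  by rewrite sum_nat_const /= card_sig.
set l2 := (#|L| ^ 2)%N in mQ e0_le; clearbody l2.
move: DQ DQ' e0_le; rewrite -[l2.+1%:R]natr1 !natrM.
set m := #|edges (induced L)| in lt mQ *; set m' := #|edges Q'| in lt *.
move=> DQ DQ' e0_le.
have ltR : m%:R + 1 <= m'%:R :> algR by rewrite natr1 ler_nat.
have mQR : 2 * m%:R <= l2%:R :> algR by rewrite -natrM ler_nat.
have l2_ge0 : 0 <= l2%:R :> algR by apply: ler0n.
have h1 : (1 - 2 * e0) ^+ 2 * (2 * (m%:R + 1)) <= (1 - 2 * e0) ^+ 2 * (2 * m'%:R).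
  by rewrite ler_wpM2l ?sqr_ge0 // ler_wpM2l.
have h2 : (1 - 2 * e0) ^+ 2 * (2 * (m%:R + 1)) <= 2 * m%:R by lra.
have h3 : e0 * (2 * m%:R) <= e0 * l2%:R.
  by apply: ler_wpM2l; [exact: ltW | lra].
have h4 : 0 <= e0 ^+ 2 * (2 * (m%:R + 1)).
  by rewrite mulr_ge0 ?sqr_ge0 // mulr_ge0 // addr_ge0 // ler0n.
have h5 : 0 <= e0 * l2%:R by rewrite mulr_ge0 // ltW.
have : (2 : algR) <= 1 by lra.
by rewrite (ler_nat algR 2 1).
Qed.
End Compare.

Section LeafCase.
Local Open Scope ring_scope.

Lemma SPEX_rho_ge (F G : sgraph) (A B : {set F}) (q n : nat) :
  is_tree F -> partite_sets A B -> (#|A| <= #|B|)%N -> (q < #|A|)%N ->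
  (0 < q < n)%N -> SPEX n F G -> (q * (n - q))%:R <= rhoR G ^+ 2.
Proof.
move=> F_tree AB leAB ltqA /andP[q_gt0 lt_qn] [Gn Gfree Gmax].
have le : rhoR (join (edgeless q) (edgeless (n - q))) <= rhoR G.
  apply: Gmax; first by rewrite card_sum !card_ord subnKC // ltnW.
  exact: edgeless_join_free F_tree AB leAB _.
apply: le_trans (_ : rhoR (join (edgeless q) (edgeless (n - q))) ^+ 2 <= _).
  by rewrite natrM; apply: rho_edgeless_join_ge => //; rewrite subn_gt0.
by rewrite lerXn2r // nnegrE rhoR_ge0.
Qed.

Lemma leaf_structure (F G : sgraph) (A B : {set F}) (a : F) (q n K : nat)
    (e0 eta : algR) (k := #|F|) (N : algR := #|G|%:R) (kap : algR := k%:R) :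
  is_tree F -> partite_sets A B -> (#|A| <= #|B|)%N -> #|A| = q.+1 -> (0 < q)%N ->
  a \in A -> deg a = 1%N -> (2 * k + 4 <= n)%N ->
  0 < e0 -> 1000 * kap ^+ 2 * e0 = 1 -> 4 * kap * eta = e0 ->
  16 * kap ^+ 2 <= eta * K%:R -> 128 * kap ^+ 3 <= eta ^+ 2 * rhoR G ->
  q%:R ^+ 2 + (K * 2 ^ K * k)%:R <= e0 * N / 2 ->
  SPEX n F G -> calH n q (cover_family F q) G.
Proof.
move=> F_tree AB leAB Aq q_gt0 aA da n_ge e0_gt0 e0E eta_def K_large lam_eta N_large GS.
have [_ _ F_acyclic] := F_tree; have cA := partite_cover AB.
have le_qk : (q <= k)%N by have : (#|A| <= k)%N := max_card _; rewrite Aq; exact: ltnW.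
have k_gt0 : (0 < k)%N := leq_trans q_gt0 le_qk.
have [le_kn lt_qn] : (k <= n - q)%N /\ (q < n)%N by clear -n_ge le_qk; lia.
have lam_large : q%:R * (N - q%:R) <= rhoR G ^+ 2.
  have [Gn _ _] := GS; rewrite /N Gn -natrB ?(ltnW lt_qn) // -natrM.
  by apply: SPEX_rho_ge F_tree AB leAB _ _ GS; rewrite ?Aq // q_gt0.
have [Gn Gfree Gmax] := GS.
have G_gt0 : (0 < #|G|)%N by rewrite Gn (leq_ltn_trans _ lt_qn).
have G_deg : degenerate G k := forest_free_degenerate F_acyclic Gfree.
have G_common (L : {set G}) : #|L| = q.+1 -> (#|common L| < k)%N.
  have [_ _ iA _] := AB.
  by move=> Lq; apply: (common_small cA iA Gfree); rewrite Aq Lq.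
have [x [xE x_ge0 x_le1 [u0 xu0]]] := perron_normalized G_gt0.
have kap_ge1 : 1 <= kap by rewrite ler1n.
have kap2_ge1 : 1 <= kap ^+ 2 by rewrite exprn_ege1.
have le_q2 : q%:R ^+ 2 <= kap ^+ 2 by rewrite lerXn2r ?nnegrE ?ler0n // ler_nat.
have le_qkap2 : q%:R <= kap ^+ 2.
  apply: le_trans le_q2; rewrite expr2 ler_peMl ?ler0n // ler1n //.
have e0_small : 1000 * kap ^+ 2 * e0 <= 1 by rewrite e0E.
have lam_gt0 : 0 < rhoR G.
  rewrite lt_neqAle rhoR_ge0 andbT; apply: contraTneq lam_eta => <-.
  rewrite mulr0 -ltNge mulr_gt0 // exprn_gt0 //.
  exact: lt_le_trans ltr01 kap_ge1.
have e0_le : e0 <= 1 / 1000.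
  have : 1 * e0 <= kap ^+ 2 * e0 by rewrite ler_wpM2r ?(ltW e0_gt0).
  by move: e0E; clear; lra.
have [L [Lq xL LR]] := localization G_deg G_common xE x_ge0 x_le1 lam_gt0 q_gt0
  le_qk lam_large e0_gt0 e0_small eta_def K_large lam_eta N_large xu0.
have cL : (k.+2 <= #|common L|)%N.
  have h1 : #|~: common L|%:R <= N / 2.
    apply: le_trans LR _; rewrite -/N.
    have h2 : q%:R * e0 <= kap ^+ 2 * e0 by rewrite ler_wpM2r ?(ltW e0_gt0).
    have N_ge0 : 0 <= N by apply: ler0n.
    have h3 : q%:R * e0 * N <= kap ^+ 2 * e0 * N by rewrite ler_wpM2r.
    have h4 : 1000 * kap ^+ 2 * e0 * N = N by rewrite e0E mul1r.
    by move: h3 h4 N_ge0; clear; lra.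
  have h2 : (2 * #|~: common L| <= n)%N.
    by rewrite -(ler_nat algR) natrM; move: h1; rewrite /N Gn; clear; lra.
  have := cardsC (common L); rewrite Gn; move: h2 n_ge; clear.
  by move: #|_| #|_| => c d; lia.
have Rnbr : forall r, r \in common L -> nbr r \subset L.
  by apply: (leaf_common_nbr AB aA da Gfree) => //; rewrite Aq Lq.
have xsmall := residual_small G_deg xE x_ge0 x_le1 lam_gt0 q_gt0
  le_qk lam_large e0_gt0 e0_small eta_def K_large lam_eta N_large Lq LR Rnbr.
have L0 : L != set0 by rewrite -card_gt0 Lq.
have LT : L :|: common L = setT.
  apply: (residual_empty x_ge0 xE G_deg k_gt0 _ e0_le L0 xL Rnbr xsmall).
  by apply: Gmax => //; apply: cone_adj_free => //; apply/ltnW/ltnW.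
have isoG : iso G (join (induced L) (edgeless (n - q))).
  rewrite -Lq; apply: cone_iso => // u v uL.
  have uR : u \in common L.
    by have := in_setT u; rewrite -LT in_setU (negbTE uL).
  rewrite -in_nbr (_ : nbr u = L) //; apply/eqP; rewrite eqEsubset Rnbr //=.
  by move: uR; rewrite inE.
have leb : (beta F <= q.+1)%N by rewrite -Aq; apply: beta_le.
exists (induced L) => //.
have Qq : #|induced L| = q by rewrite /= card_sig.
have Qfree : family_free (cover_family F q) (induced L).
  apply/(family_freeP leb Qq le_kn) => Fin; apply: Gfree.
  exact: contains_isol (iso_sym isoG) Fin.
split=> //; split; first by exists (induced L).
move=> Q' Q'q Q'free.
have [y0 _] : exists y, y \in Q' by apply/card_gt0P; rewrite Q'q.
have [|g [g_inj _]] := @inj_on_exists G Q' L setT _ y0; first by rewrite cardsT Q'q Lq.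
apply: (edges_le_of_rho x_ge0 xE LT Rnbr _ g_inj e0_gt0 _ xL x_le1).
- by rewrite Q'q Lq.
- have h1 : (#|L| ^ 2).+1%:R <= 2 * kap ^+ 2.
    by rewrite -natr1 Lq natrX; move: le_q2 kap2_ge1; clear; lra.
  have : (#|L| ^ 2).+1%:R * e0 <= 2 * kap ^+ 2 * e0 by rewrite ler_wpM2r // ltW.
  by move: e0E; clear; lra.
(* A copy of [F] in the cone over [Q'] would embed one of its covers into [Q']. *)
apply: Gmax => //; case=> f f_inj f_adj.
have [cS leS f_adj'] := contains_cone f_inj f_adj.
have /(family_freeP leb Q'q le_kn) := Q'free; apply.
apply: (cover_join_contains cS _ le_kn).
exists (fun u => g (f (val u))) => [u v e|u v uv].
  apply/val_inj/f_inj/g_inj => //; first by have := valP u; rewrite inE.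
  by have := valP v; rewrite inE.
by apply: (f_adj' (val u) (val v)) uv; apply: valP.
Qed.

Lemma leaf_SPEX (F : sgraph) (A B : {set F}) (a : F) (q : nat) :
  is_tree F -> partite_sets A B -> (#|A| <= #|B|)%N -> #|A| = q.+1 -> (0 < q)%N ->
  a \in A -> deg a = 1%N ->
  exists n0, forall n, (n0 <= n)%N ->
    forall G, SPEX n F G -> calH n q (cover_family F q) G.
Proof.
move=> F_tree AB leAB Aq q_gt0 aA da; set k := #|F|.
have le_qk : (q <= k)%N by have : (#|A| <= k)%N := max_card _; rewrite Aq; exact: ltnW.
have k_gt0 : (0 < k)%N := leq_trans q_gt0 le_qk.
(* [h] and [K] are the inverse of [eta] and the bound on the number of heavy
   vertices, and [P] is the size of [rho G] that the estimates require. *)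
have [h hE] : exists h, h = (4 * 1000 * k ^ 3)%N := ex_intro _ _ erefl.
have [K KE] : exists K, K = (16 * k ^ 2 * h)%N := ex_intro _ _ erefl.
have [P PE] : exists P, P = (128 * k ^ 3 * h ^ 2)%N := ex_intro _ _ erefl.
have [C CE] : exists C, C = (K * 2 ^ K * k)%N := ex_intro _ _ erefl.
(* The first term gives [P ^ 2 <= n - q], hence [P <= rho G]. The second is [2 / e0] times
   [k ^ 2 + C], which bounds [q ^ 2 + C]. *)
exists (maxn (P ^ 2 + 2 * k + 4) (2 * 1000 * k ^ 2 * (k ^ 2 + C))) => n.
rewrite geq_max => /andP[n_ge n_ge'] G GS.
have [n_ge4 P_le lt_qn] : [/\ 2 * k + 4 <= n, P ^ 2 <= n - q & q < n]%N.
  by move: (P ^ 2)%N n_ge le_qk; clear => P2 ? ?; split; lia.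
have lam_P : P%:R <= rhoR G.
  rewrite -(ler_pXn2r (n := 2)) ?nnegrE ?ler0n ?rhoR_ge0 //.
  have ltqA : (q < #|A|)%N by rewrite Aq.
  have q_bounds : (0 < q < n)%N by rewrite q_gt0.
  apply: le_trans (SPEX_rho_ge F_tree AB leAB ltqA q_bounds GS).
  by rewrite -natrX ler_nat; apply: leq_trans P_le (leq_pmull _ q_gt0).
pose kap : algR := k%:R.
have kap_gt0 : 0 < kap by rewrite ltr0n.
have kap0 : kap != 0 by rewrite gt_eqF.
have kap2_gt0 : 0 < kap ^+ 2 by rewrite exprn_gt0.
have kap3_gt0 : 0 < kap ^+ 3 by rewrite exprn_gt0.
pose e0 : algR := (1000 * kap ^+ 2)^-1.
pose eta : algR := (4 * 1000 * kap ^+ 3)^-1.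
have e0_gt0 : 0 < e0 by rewrite invr_gt0; move: kap2_gt0; clear; lra.
have e0E : 1000 * kap ^+ 2 * e0 = 1.
  by rewrite divff // gt_eqF //; move: kap2_gt0; clear; lra.
have eta_gt0 : 0 < eta by rewrite invr_gt0; move: kap3_gt0; clear; lra.
have eta0 : eta != 0 by rewrite gt_eqF.
have eta_def : 4 * kap * eta = e0 by rewrite /eta /e0; field.
have hR : h%:R = eta^-1 by rewrite /eta invrK hE natrM natrX natrM.
have [Gn _ _] := GS.
apply: (leaf_structure (K := K) F_tree AB leAB Aq q_gt0 aA da n_ge4
  e0_gt0 e0E eta_def) GS.
- rewrite -/kap KE 2!natrM natrX hR -/kap le_eqVlt; apply/orP; left; apply/eqP.
  by rewrite [RHS]mulrCA mulfV // mulr1.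
- apply: le_trans (_ : eta ^+ 2 * P%:R <= _); last by rewrite ler_wpM2l // sqr_ge0.
  rewrite PE 2!natrM !natrX hR -/kap le_eqVlt; apply/orP; left; apply/eqP.
  by field.
rewrite -CE Gn.
have le_q2 : q%:R ^+ 2 <= kap ^+ 2 by rewrite lerXn2r ?nnegrE ?ler0n // ler_nat.
have h1 : 2 * 1000 * kap ^+ 2 * (kap ^+ 2 + C%:R) <= n%:R.
  by move: n_ge'; rewrite -(ler_nat algR) 2!natrM natrD !natrX natrM.
have h2 : e0 * (2 * 1000 * kap ^+ 2 * (kap ^+ 2 + C%:R)) <= e0 * n%:R.
  by rewrite ler_wpM2l // ltW.
have h3 : e0 * (2 * 1000 * kap ^+ 2 * (kap ^+ 2 + C%:R)) = 2 * (kap ^+ 2 + C%:R).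
  have -> : e0 * (2 * 1000 * kap ^+ 2 * (kap ^+ 2 + C%:R)) =
    (1000 * kap ^+ 2 * e0) * (2 * (kap ^+ 2 + C%:R)) by ring.
  by rewrite e0E mul1r.
by move: le_q2 h2 h3; clear; lra.
Qed.

End LeafCase.

(** * Assembly of the three equivalences *)

Lemma iso_refl (G : sgraph) : iso G G.
Proof. by exists id; first exists id. Qed.

Theorem theorem1p5 (F : sgraph) (l : nat) (A B : {set F}) (q delta : nat)
  (F_tree : is_tree F) (card_F : #|F| = l) (l_ge4 : 4 <= l)
  (AB : partite_sets A B) (le_AB : #|A| <= #|B|)
  (q_def : q = #|A| - 1) (delta_def : delta = min_deg_in A) (q_ge1 : 1 <= q) :
  exists N : nat, forall n : nat, N <= n ->
    [/\ (forall G : sgraph, SPEX n F G -> calH n q (cover_family F q) G)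
          <-> delta = 1,
        is_singleton (SPEX n F) (complete_bipartite q (n - q))
          <-> delta = 1 /\ is_singleton (EX q (cover_family F q)) (edgeless q)
      & is_singleton (SPEX n F) (S0 n q)
          <-> delta = 1 /\ beta F = q.+1].
Proof.
have Aq : #|A| = q.+1 by lia.
have [_ _ F_acyclic] := F_tree.
(* [delta] is determined before [n], so the threshold may depend on it; if [delta] is not 1 the
   claim is vacuous. *)
have [N0 leafH] : exists N, forall n, N <= n -> delta = 1 ->
    forall G, SPEX n F G -> calH n q (cover_family F q) G.
  have [d1|nd1] := eqVneq delta 1; last first.
    by exists 0 => n _ d1; rewrite d1 eqxx in nd1.
  have [|a aA da] := @min_deg_in_attained F A.
    by rewrite -card_gt0 Aq.
  have [|N HN] := leaf_SPEX F_tree AB le_AB Aq q_ge1 aA.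
    by rewrite da -delta_def.
  by exists N => n /HN.
exists (maxn N0 (2 * #|F| + 2)) => n; rewrite geq_max => /andP[/leafH {}leafH n_ge].
have le_qF : q < #|F| by have : #|A| <= #|F| := max_card _; lia.
have n_gt0 : 0 < n by lia.
have le_qn : q <= n by lia.
have leFm : #|F| <= n - q by lia.
have leb : beta F <= q.+1 by rewrite -Aq; apply/beta_le/partite_cover/AB.
have edgeless_free : ~ contains (join (edgeless q) (edgeless (n - q))) F.
  by apply: edgeless_join_free F_tree AB le_AB _; rewrite Aq.
(* Without an extremal graph the inclusion in [calH] could hold vacuously and would say nothing
   about [delta]. The singleton claims also need one. *)
have [G0 G0S] : exists G, SPEX n F G.
  apply: SPEX_exists n_gt0 _ edgeless_free.
  by rewrite card_sum !card_ord subnKC.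
(* All three forward directions reach [delta = 1] this way, as each exhibits an extremal graph that
   is such a join. *)
have join_SPEX (Q : sgraph) : #|Q| = q -> SPEX n F (join Q (edgeless (n - q))) ->
    delta = 1.
  move=> Qq QS; apply: contraPeq QS => nd1.
  apply: no_leaf_not_SPEX F_acyclic AB _ _ _ _; rewrite ?Qq ?Aq //; last by lia.
  move=> y yA; rewrite ltn_neqAle eq_sym tree_deg_gt0 //; last by lia.
  rewrite andbT; apply: contra nd1 => /eqP dy.
  have [|a aA da] := @min_deg_in_attained F A; first by rewrite -card_gt0 Aq.
  have := min_deg_in_le yA; rewrite dy -delta_def.
  have := tree_deg_gt0 a F_tree; rewrite da -delta_def.
  by rewrite card_F => /(_ (ltnW (ltnW l_ge4))) d_gt0 d_le; rewrite eqn_leq d_le.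
have ex_unique m m' : is_ex q (cover_family F q) m ->
    is_ex q (cover_family F q) m' -> m = m'.
  move=> [[G [Gq Gf <-]] G_max] [[G' [Gq' Gf' <-]] G'_max].
  by apply/eqP; rewrite eqn_leq G'_max // G_max.
have KB := complete_bipartite_iso q (n - q).
split; split.
- move=> sub; have [Q [Qq _ _] isoQ] := sub G0 G0S.
  exact: join_SPEX Qq (SPEX_iso n_gt0 isoQ G0S).
- exact: leafH.
- move=> sing; have KS : SPEX n F (complete_bipartite q (n - q)).
    by apply/sing; apply: iso_refl.
  have d1 : delta = 1.
    by apply: (join_SPEX (edgeless q)) (SPEX_iso n_gt0 KB KS); rewrite /= card_ord.
  split=> //; have [Q [Qq Qfree Qex] isoQ] := leafH d1 _ KS.
  (* The isomorphism need not match the parts of the two joins, so [Q] is recognized by counting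
     edges. *)
  have Q0 : #|edges Q| = 0.
    have /iso_deg_sum := iso_trans (iso_sym KB) isoQ.
    rewrite !deg_sum_join_edgeless !handshake edgeless_edges Qq /= card_ord; lia.
  rewrite Q0 in Qex; move=> G; split=> [[Gq _ /ex_unique/(_ Qex)]|isoG].
    exact: edgeless_iso.
  have Gq : #|G| = q by rewrite (iso_card isoG) /= card_ord.
  split=> //; last by rewrite (iso_edges isoG) edgeless_edges.
  have e_ff : family_free (cover_family F q) (edgeless q).
    by apply/(family_freeP leb _ leFm) => //=; rewrite card_ord.
  by move=> H /e_ff + GH; apply; apply: contains_isol isoG GH.
- case=> d1 sing; have SK G : SPEX n F G -> iso G (complete_bipartite q (n - q)).
    move=> /(leafH d1)[Q /sing isoQ isoG]; apply: iso_trans isoG _.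
    exact: iso_trans (join_isol _ isoQ) (iso_sym KB).
  move=> G; split=> [/SK //|isoG].
  exact: SPEX_iso n_gt0 (iso_trans (SK _ G0S) (iso_sym isoG)) G0S.
- move=> sing; have S0S : SPEX n F (S0 n q) by apply/sing; apply: iso_refl.
  split; first by apply: (join_SPEX (complete q)) S0S; rewrite /= card_ord.
  (* A cover of at most [q] vertices would fit into the complete graph, and [S0 n q] would contain
     [F]. *)
  apply/eqP; rewrite eqn_leq leb ltnNge; apply/negP => beta_q.
  have [S cS Sb] := beta_attained F; have [_ + _] := S0S; apply.
  apply: (cover_join_contains cS) leFm.
  have [|g [g_inj _]] :=
      @inj_on_exists (induced S) (complete q) setT setT _ (Ordinal q_ge1).
    by rewrite !cardsT /= card_sig card_ord Sb.
  exists g => [u v|u v uv]; first by apply: g_inj; rewrite inE.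
  rewrite /= /complete_adj (inj_in_eq g_inj) ?inE //.
  by apply: contraTneq uv => ->; rewrite adj_irrefl.
- case=> d1 bq; have SK G : SPEX n F G -> iso G (S0 n q).
    move=> /(leafH d1)[Q [Qq _ [_ Qmax]] isoG]; apply: iso_trans isoG _.
    (* The complete graph on [q] vertices is itself family-free, so the extremal [Q] has at least as
       many edges. *)
    apply/join_isol/complete_iso => //; apply: Qmax; first by rewrite /= card_ord.
    move=> H; rewrite /cover_family bq eqxx => HK KH.
    have [f /leq_card] := contains_isor HK KH.
    by rewrite /= !card_ord ltnn.
  move=> G; split=> [/SK //|isoG].
  exact: SPEX_iso n_gt0 (iso_trans (SK _ G0S) (iso_sym isoG)) G0S.
Qed.
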